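(* Let $p>0$ and let $\mathcal{S}_p=\{x^{-p}e^{ix} : 1<x<\infty\}\subset\mathbb{C}$. Suppose there exists an $(\alpha,\beta)$-Hölder homeomorphism between $(0,1)$ and $\mathcal{S}_p$. Then $$\alpha\leq\min\left\{\frac{p\beta}{p+\beta},\,1\right\},$$ and this bound is sharp. Based on knowledge of the Assouad spectrum (of $\mathcal{S}_p$), we have $$\alpha\leq\min\left\{\frac{p\beta+\beta}{p+2\beta},\,1\right\},$$ which is not sharp, and based on knowledge of the box dimension (of $\mathcal{S}_p$), we have $$\alpha\leq\min\left\{\frac{p+1}{2},\,1\right\},$$ which is also not sharp.
   Context: For $X,Y\subset\mathbb{C}$ and $0<\alpha\leq1\leq\beta<\infty$, a homeomorphism $f:X\to Y$ is $(\alpha,\beta)$-Hölder if there is a constant $C>0$ such that $C^{-1}|x-y|^\beta\leq|f(x)-f(y)|\leq C|x-y|^\alpha$ for all $x,y\in X$. A homeomorphism between $(0,1)$ and $\mathcal{S}_p$ is here a map $f:(0,1)\to\mathcal{S}_p$. For a non-empty bounded set $F\subset\mathbb{R}^d$ (with $\mathbb{C}$ identified with $\mathbb{R}^2$), let $N_r(F)$ be the smallest number of sets required for an $r$-cover of $F$. The box dimension of $F$ is $\lim_{r\to0}\frac{\log N_r(F)}{-\log r}$, when this limit exists. The Assouad spectrum of $F$ is the function which maps $\theta\in(0,1)$ to the infimum of all $s$ for which there exists $C>0$ such that, for all $0<r<1$ and $x\in F$, $N_r(B(x,r^\theta)\cap F)\leq C(r^\theta/r)^s$. A bound ''based on knowledge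 of'' one of these dimensions is one derived from the value of that dimension for $\mathcal{S}_p$ together with general results on how the dimension can change under Hölder or $(\alpha,\beta)$-Hölder maps. *)

(* Defs.v *)
From Stdlib Require Import Reals ClassicalEpsilon.
From Coquelicot Require Import Coquelicot.

Set Implicit Arguments.
Unset Strict Implicit.
Unset Printing Implicit Defensive.

Open Scope R_scope.

(* Subsets of the plane are predicates C -> Prop; a map X -> Y between them is
   a total function C -> C of which only the values on X matter. *)

Definition Cdist (x y : C) : R := Cmod (Cminus x y).

Definition nonempty (F : C -> Prop) : Prop := exists z : C, F z.

Definition bounded (F : C -> Prop) : Prop :=
  exists M : R, forall z : C, F z -> Cmod z <= M.

Definition unit_interval (z : C) : Prop :=
  exists t : R, 0 < t < 1 /\ z = RtoC t.

(* The point x^(-p) e^(ix), with e^(ix) = (cos x, sin x). *)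
Definition spiral (p : R) (z : C) : Prop :=
  exists x : R, 1 < x /\ z = Cmult (RtoC (Rpower x (- p))) (cos x, sin x).

Definition continuous_within (X : C -> Prop) (f : C -> C) : Prop :=
  forall x : C, X x ->
    filterlim f (within X (@locally C_UniformSpace x))
      (@locally C_UniformSpace (f x)).

Definition homeomorphism (X Y : C -> Prop) (f : C -> C) : Prop :=
  (forall x : C, X x -> Y (f x)) /\
  continuous_within X f /\
  exists g : C -> C,
    (forall y : C, Y y -> X (g y)) /\
    continuous_within Y g /\
    (forall x : C, X x -> g (f x) = x) /\
    (forall y : C, Y y -> f (g y) = y).

(* In the two conditions below x <> y loses nothing, since both sides vanish
   when x = y; it is needed because Rpower 0 a = 1 in the library. *)
Definition holder_map (alpha : R) (X : C -> Prop) (f : C -> C) : Prop :=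
  exists K : R, 0 < K /\
    forall x y : C, X x -> X y -> x <> y ->
      Cdist (f x) (f y) <= K * Rpower (Cdist x y) alpha.

Definition holder_homeomorphism
    (alpha beta : R) (X Y : C -> Prop) (f : C -> C) : Prop :=
  homeomorphism X Y f /\
  exists K : R, 0 < K /\
    forall x y : C, X x -> X y -> x <> y ->
      / K * Rpower (Cdist x y) beta <= Cdist (f x) (f y) <=
      K * Rpower (Cdist x y) alpha.

(* F has an r-cover by n sets, i.e. a cover by n sets of diameter at most r. *)
Definition has_cover (r : R) (F : C -> Prop) (n : nat) : Prop :=
  exists U : nat -> C -> Prop,
    (forall i : nat, (i < n)%nat ->
       forall z w : C, U i z -> U i w -> Cdist z w <= r) /\
    (forall z : C, F z -> exists i : nat, (i < n)%nat /\ U i z).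

(* N_r(F); an arbitrary number if F has no finite r-cover, which does not
   happen for bounded F and r > 0. *)
Definition covering_number (r : R) (F : C -> Prop) : nat :=
  epsilon (inhabits 0%nat)
    (fun n : nat => has_cover r F n /\
       forall m : nat, has_cover r F m -> (n <= m)%nat).

Definition is_box_dim (F : C -> Prop) (d : R) : Prop :=
  filterlim (fun r : R => ln (INR (covering_number r F)) / - ln r)
    (at_right 0) (locally d).

Definition ex_box_dim (F : C -> Prop) : Prop := exists d : R, is_box_dim F d.

Definition ball_in (F : C -> Prop) (x : C) (rho : R) : C -> Prop :=
  fun z : C => F z /\ Cdist z x <= rho.

(* The infimum is finite for non-empty bounded F: every s in the set is
   nonnegative, and s = 2 belongs to it. *)
Definition assouad_spectrum (theta : R) (F : C -> Prop) : R :=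
  real (Glb_Rbar (fun s : R =>
    exists K : R, 0 < K /\
      forall (r : R) (x : C), 0 < r < 1 -> F x ->
        INR (covering_number r (ball_in F x (Rpower r theta))) <=
        K * Rpower (Rpower r theta / r) s)).

(* The constraint which the dimensions of X and Y put on the exponents of an
   (alpha, beta)-Hölder homeomorphism X -> Y: a cover of
   B(x, r^(theta/beta)) in X by sets of diameter r^(1/alpha) is mapped, up to
   constants, to an r-cover of B(f x, r^theta) in Y, and
   r^(theta/beta) = (r^(1/alpha))^(alpha theta/beta). *)
Definition assouad_allows (alpha beta : R) (X Y : C -> Prop) : Prop :=
  forall theta : R, 0 < theta < 1 ->
    assouad_spectrum theta Y <=
    (beta - alpha * theta) / (alpha * beta * (1 - theta)) *
    assouad_spectrum (alpha * theta / beta) X.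

Definition box_allows (alpha : R) (X Y : C -> Prop) : Prop :=
  forall dX dY : R, is_box_dim X dX -> is_box_dim Y dY -> dY <= dX / alpha.

Definition assouad_distortion : Prop :=
  forall (alpha beta : R) (X Y : C -> Prop) (f : C -> C),
    0 < alpha <= 1 -> 1 <= beta ->
    nonempty X -> bounded X -> nonempty Y -> bounded Y ->
    holder_homeomorphism alpha beta X Y f ->
    assouad_allows alpha beta X Y.

Definition box_distortion : Prop :=
  forall (alpha : R) (X Y : C -> Prop) (f : C -> C),
    0 < alpha <= 1 ->
    nonempty X -> bounded X -> nonempty Y -> bounded Y ->
    (forall y : C, Y y <-> exists x : C, X x /\ f x = y) ->
    holder_map alpha X f ->
    box_allows alpha X Y.

Definition winding_exponent (p beta alpha : R) : Prop :=
  0 < alpha <= 1 /\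
  exists f : C -> C, holder_homeomorphism alpha beta unit_interval (spiral p) f.

Definition winding_bound (p : R) (b : R -> R) : Prop :=
  forall alpha beta : R, 1 <= beta -> winding_exponent p beta alpha ->
    alpha <= b beta.

(* The bound cannot be improved for the given beta. *)
Definition sharp_at (p beta : R) (b : R -> R) : Prop :=
  is_lub (winding_exponent p beta) (b beta).

Definition sharp (p : R) (b : R -> R) : Prop :=
  forall beta : R, 1 <= beta -> sharp_at p beta b.

(* Main.v *)
From Stdlib Require Import Reals Lra Lia ZArith List FinFun Classical ClassicalEpsilon Wf_nat.
From Stdlib Require Ranalysis5.
From Coquelicot Require Import Coquelicot.
Require Import Defs.

(* If f maps (0,1) onto the spiral, consecutive half-turns at x = pi k, ..., 2 pi k have diameter
   about k^(-p), so the upper Hölder bound makes each of their k preimages longer than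
   c k^(-p/alpha); these are adjacent intervals, contained in the preimage of a ball of radius
   about k^(-p), which the lower bound makes shorter than C k^(-p/beta). Hence
   1 - p/alpha <= -p/beta. The map t |-> t^beta e^(i t^(-beta/p)) attains equality, its lower
   bound coming from the radii alone because t^beta is superadditive.
   The Assouad constraint is governed by theta = p/(p+1), where the spectrum of the spiral reaches
   2: the turns through radius r^theta are about r apart, hence fill a disc at scale r. *)

Open Scope R_scope.

(** * Covers *)

(** What separates the sharp bound from the two dimension bounds is order on the line: covering
    numbers only count pieces, whereas the preimages of consecutive half-turns are adjacent, so
    their lengths add up inside one short interval. That additivity comes from the intermediate
    value theorem for the inverse map read along the angle. A bound based on a dimension is stated
    as an equivalence, so the Assouad constraint must be evaluated for every [theta], not only at
    [p/(p+1)]. Upper bounds on the spectrum suffice for the converse: [2] from [p/(p+1)] on, and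
    below it [2/((p+1)(1-theta))] for [p <= 1] and [1 + theta/(p(1-theta))] for [p > 1]. All of them
    equal [2] at [theta = p/(p+1)]. The last two, and the box dimension, come from one count of unit
    arcs, whose only loss is a logarithm. *)

Lemma Cdist_sym (x y : C) : Cdist x y = Cdist y x.
Proof.
  unfold Cdist. rewrite <- (Cmod_opp (Cminus x y)). f_equal. ring.
Qed.

Lemma Cdist_triangle (x y z : C) : Cdist x z <= Cdist x y + Cdist y z.
Proof.
  unfold Cdist. replace (Cminus x z) with (Cplus (Cminus x y) (Cminus y z)) by ring.
  apply Cmod_triangle.
Qed.

Lemma Cdist_refl (x : C) : Cdist x x = 0.
Proof.
  unfold Cdist. replace (Cminus x x) with (RtoC 0) by ring. apply Cmod_0.
Qed.

Lemma Cdist_ge_0 (x y : C) : 0 <= Cdist x y.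
Proof. apply Cmod_ge_0. Qed.

Lemma Cdist_eq_0 (x y : C) : Cdist x y = 0 -> x = y.
Proof.
  intros H. apply Cmod_eq_0 in H.
  replace x with (Cplus (Cminus x y) y) by ring. rewrite H. ring.
Qed.

Lemma Cdist_gt_0 (x y : C) : x <> y -> 0 < Cdist x y.
Proof.
  intros H. destruct (Cdist_ge_0 x y) as [h | h]; [exact h |].
  exfalso. apply H, Cdist_eq_0. now symmetry.
Qed.

Lemma Cdist_R (a b : R) : Cdist (RtoC a) (RtoC b) = Rabs (a - b).
Proof. unfold Cdist. rewrite <- RtoC_minus. apply Cmod_R. Qed.

Lemma Cmod_le_Cdist (x y : C) : Cmod x <= Cdist x y + Cmod y.
Proof.
  unfold Cdist. replace x with (Cplus (Cminus x y) y) at 1 by ring. apply Cmod_triangle.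
Qed.

Lemma Cdist_le_Cmod (x y : C) : Cdist x y <= Cmod x + Cmod y.
Proof.
  unfold Cdist, Cminus. rewrite <- (Cmod_opp y). apply Cmod_triangle.
Qed.

Lemma Rabs_Cmod_minus (x y : C) : Rabs (Cmod x - Cmod y) <= Cdist x y.
Proof.
  apply Rabs_le. pose proof (Cmod_le_Cdist x y). pose proof (Cmod_le_Cdist y x).
  rewrite (Cdist_sym y x) in *. lra.
Qed.

Lemma Cdist_le_coords (x y : C) :
  Cdist x y <= Rabs (fst x - fst y) + Rabs (snd x - snd y).
Proof.
  unfold Cdist, Cmod, Cminus, Cplus, Copp; cbn [fst snd].
  fold (fst x - fst y). fold (snd x - snd y).
  apply Rsqr_incr_0_var.
  - rewrite Rsqr_sqrt by (apply Rplus_le_le_0_compat; apply pow2_ge_0). unfold Rsqr.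
    pose proof (Rabs_pos (fst x - fst y)). pose proof (Rabs_pos (snd x - snd y)).
    pose proof (Rsqr_abs (fst x - fst y)) as h1. pose proof (Rsqr_abs (snd x - snd y)) as h2.
    unfold Rsqr in *. nra.
  - apply Rplus_le_le_0_compat; apply Rabs_pos.
Qed.

Lemma Rabs_fst_le_Cdist (x y : C) : Rabs (fst x - fst y) <= Cdist x y.
Proof.
  unfold Cdist. pose proof (Rmax_Cmod (Cminus x y)) as h. simpl in h.
  eapply Rle_trans; [| exact h]. apply Rmax_l.
Qed.

Lemma Rabs_snd_le_Cdist (x y : C) : Rabs (snd x - snd y) <= Cdist x y.
Proof.
  unfold Cdist. pose proof (Rmax_Cmod (Cminus x y)) as h. simpl in h.
  eapply Rle_trans; [| exact h]. apply Rmax_r.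
Qed.

Lemma nat_ceil (x : R) : 0 <= x -> exists n : nat, x <= INR n < x + 1.
Proof.
  intros hx. destruct (archimed x) as [h1 h2].
  assert (h : (0 <= up x)%Z) by (apply le_IZR; lra).
  destruct (Req_dec (IZR (up x) - 1) x) as [e | ne].
  - exists (Z.to_nat (up x - 1)). rewrite INR_IZR_INZ, Z2Nat.id, minus_IZR; [lra |].
    assert (0 < up x)%Z by (apply lt_IZR; lra). lia.
  - exists (Z.to_nat (up x)). rewrite INR_IZR_INZ, Z2Nat.id by exact h. lra.
Qed.

Lemma grid_index (w t : R) (k : nat) :
  (0 < k)%nat -> 0 <= t <= INR k * w ->
  exists a : nat, (a < k)%nat /\ INR a * w <= t <= (INR a + 1) * w.
Proof.
  intros hk. destruct k as [| k]; [lia |]. clear hk. induction k as [| k IH]; intros ht.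
  - exists 0%nat. simpl in *. split; [lia | lra].
  - destruct (Rle_lt_dec t (INR (S k) * w)) as [h | h].
    + destruct IH as [a [ha h']]; [lra |]. exists a. split; [lia | exact h'].
    + exists (S k). rewrite (S_INR (S k)) in ht. split; [lia | lra].
Qed.

Lemma has_cover_weaken (r r' : R) (F G : C -> Prop) (n : nat) :
  r <= r' -> (forall z, G z -> F z) -> has_cover r F n -> has_cover r' G n.
Proof.
  intros hr hFG [U [h1 h2]]. exists U. split.
  - intros i hi z w hz hw. specialize (h1 i hi z w hz hw). lra.
  - intros z hz. apply h2, hFG, hz.
Qed.

Lemma has_cover_union (r : R) (F G : C -> Prop) (n m : nat) :
  has_cover r F n -> has_cover r G m -> has_cover r (fun z => F z \/ G z) (n + m).
Proof.
  intros [U [hU1 hU2]] [V [hV1 hV2]].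
  exists (fun i => if (i <? n)%nat then U i else V (i - n)%nat). split.
  - intros i hi z w. destruct (Nat.ltb_spec i n) as [h | h].
    + apply hU1, h.
    + apply hV1. lia.
  - intros z [hz | hz].
    + destruct (hU2 z hz) as [i [hi hz']]. exists i. split; [lia |].
      destruct (Nat.ltb_spec i n); [exact hz' | lia].
    + destruct (hV2 z hz) as [i [hi hz']]. exists (n + i)%nat. split; [lia |].
      destruct (Nat.ltb_spec (n + i) n); [lia |].
      replace (n + i - n)%nat with i by lia. exact hz'.
Qed.

(** A real bound on the number of sets lets estimates be added and multiplied without rounding. *)
Definition covered (r : R) (F : C -> Prop) (t : R) : Prop :=
  exists n : nat, has_cover r F n /\ INR n <= t.

Lemma covered_weaken (r r' : R) (F G : C -> Prop) (t t' : R) :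
  r <= r' -> (forall z, G z -> F z) -> t <= t' -> covered r F t -> covered r' G t'.
Proof.
  intros hr hFG ht [n [hn hnt]]. exists n. split; [| lra].
  eapply has_cover_weaken; eauto.
Qed.

Lemma covered_union (r : R) (F G : C -> Prop) (s t : R) :
  covered r F s -> covered r G t -> covered r (fun z => F z \/ G z) (s + t).
Proof.
  intros [n [hn hns]] [m [hm hmt]]. exists (n + m)%nat. split.
  - now apply has_cover_union.
  - rewrite plus_INR. lra.
Qed.

Lemma covered_small (r : R) (F : C -> Prop) :
  (forall z w, F z -> F w -> Cdist z w <= r) -> covered r F 1.
Proof.
  intros h. exists 1%nat. split; [| simpl; lra].
  exists (fun _ => F). split.
  - intros _ _. exact h.
  - intros z hz. exists 0%nat. split; [lia | exact hz].
Qed.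

Lemma covered_bigunion (r : R) (F : nat -> C -> Prop) (b : nat -> R) (n : nat) :
  (forall i, (i < n)%nat -> covered r (F i) (b i)) ->
  covered r (fun z => exists i, (i < n)%nat /\ F i z)
    (fold_right Rplus 0 (map b (seq 0 n))).
Proof.
  induction n as [| n IH]; intros h.
  - exists 0%nat. split; [| simpl; lra].
    exists (fun _ _ => False). split.
    + intros i hi. lia.
    + intros z [i [hi _]]. lia.
  - rewrite seq_S, map_app, fold_right_app. simpl. rewrite Rplus_0_r.
    assert (e : forall l t, fold_right Rplus t l = fold_right Rplus 0 l + t).
    { intros l t. induction l as [| x l IHl]; simpl; [lra | rewrite IHl; lra]. }
    rewrite e.
    assert (hn : covered r (F n) (b n)) by (apply h; lia).
    assert (hI : covered r (fun z => exists i, (i < n)%nat /\ F i z)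
      (fold_right Rplus 0 (map b (seq 0 n)))) by (apply IH; intros i hi; apply h; lia).
    eapply covered_weaken; [| | | exact (covered_union _ _ _ _ _ hI hn)]; try lra.
    intros z [i [hi hz]]. destruct (Nat.eq_dec i n) as [-> | hne].
    + now right.
    + left. exists i. split; [lia | exact hz].
Qed.

Lemma fold_right_const (b : R) (n k : nat) :
  fold_right Rplus 0 (map (fun _ => b) (seq k n)) = INR n * b.
Proof.
  revert k. induction n as [| n IH]; intros k; [simpl; lra |].
  rewrite S_INR. simpl. rewrite IH. lra.
Qed.

Lemma covered_bigunion_const (r : R) (F : nat -> C -> Prop) (b : R) (n : nat) :
  (forall i, (i < n)%nat -> covered r (F i) b) ->
  covered r (fun z => exists i, (i < n)%nat /\ F i z) (INR n * b).
Proof.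
  intros h. rewrite <- (fold_right_const b n 0). now apply covered_bigunion.
Qed.

(** The square of side [2 rho] about [c] is cut into [k^2] cells of side [w = 2 rho / k]. Their
    diameter is at most [2 w], which is at most [r] once [k >= 4 rho / r]; rounding up keeps
    [k <= 5 rho / r], hence the 25. *)
Lemma covered_disc (r rho : R) (c : C) (F : C -> Prop) :
  0 < r <= rho -> (forall z, F z -> Cdist z c <= rho) ->
  covered r F (25 * (rho / r) ^ 2).
Proof.
  intros [hr hrho] hF.
  set (q := rho / r).
  assert (hq : 1 <= q).
  { unfold q. apply Rmult_le_reg_r with r; [lra |]. field_simplify; lra. }
  destruct (nat_ceil (4 * q)) as [k [hk1 hk2]]; [lra |].
  assert (hk : (0 < k)%nat) by (apply INR_lt; simpl; lra).
  assert (hkR : 0 < INR k) by lra.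
  set (w := 2 * rho / INR k).
  assert (hkw : INR k * w = 2 * rho) by (unfold w; field; lra).
  assert (hw : 2 * w <= r).
  { apply Rmult_le_reg_l with (INR k); [lra |].
    replace (INR k * (2 * w)) with (4 * q * r) by (unfold q; field_simplify; [lra | lra]).
    apply Rmult_le_compat_r; lra. }
  set (cell := fun a b (z : C) =>
    INR a * w <= fst z - fst c + rho <= (INR a + 1) * w /\
    INR b * w <= snd z - snd c + rho <= (INR b + 1) * w).
  assert (hcell : forall a b, covered r (cell a b) 1).
  { intros a b. apply covered_small. intros x y [hx1 hx2] [hy1 hy2].
    eapply Rle_trans; [apply Cdist_le_coords |].
    assert (Rabs (fst x - fst y) <= w) by (apply Rabs_le; lra).
    assert (Rabs (snd x - snd y) <= w) by (apply Rabs_le; lra). lra. }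
  pose proof (covered_bigunion_const r _ _ k (fun a _ =>
    covered_bigunion_const r _ _ k (fun b _ => hcell a b))) as h.
  eapply covered_weaken; [| | | exact h]; [lra | |].
  - intros z hz. specialize (hF z hz).
    pose proof (proj1 (Rabs_le_between _ _) (Rle_trans _ _ _ (Rabs_fst_le_Cdist z c) hF)) as h1.
    pose proof (proj1 (Rabs_le_between _ _) (Rle_trans _ _ _ (Rabs_snd_le_Cdist z c) hF)) as h2.
    destruct (grid_index w (fst z - fst c + rho) k hk) as [a [ha ha']]; [lra |].
    destruct (grid_index w (snd z - snd c + rho) k hk) as [b [hb hb']]; [lra |].
    exists a. split; [exact ha |]. exists b. split; [exact hb |]. now split.
  - assert (INR k <= 5 * q) by lra. nra.
Qed.

(** Shrinking the scale by a fixed factor costs a fixed factor in the count; this is how Hölder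
    constants are absorbed. *)
Lemma covered_refine (r rho : R) (F : C -> Prop) (n : nat) :
  0 < r <= rho -> has_cover rho F n -> covered r F (INR n * (25 * (rho / r) ^ 2)).
Proof.
  intros hr [U [hU1 hU2]].
  assert (h : forall i, (i < n)%nat -> covered r (U i) (25 * (rho / r) ^ 2)).
  { intros i hi. destruct (classic (exists c, U i c)) as [[c hc] | hne].
    - apply covered_disc with c; [exact hr |]. intros z hz. now apply (hU1 i).
    - exists 0%nat. split; [| simpl; pose proof (pow2_ge_0 (rho / r)); lra].
      exists (fun _ _ => False). split; [intros j hj; lia |].
      intros z hz. exfalso. apply hne. now exists z. }
  pose proof (covered_bigunion_const r U _ n h) as h'.
  eapply covered_weaken; [| | | exact h']; [lra | exact hU2 | lra].
Qed.

Lemma covered_curve (r M a L : R) (phi : R -> C) (F : C -> Prop) :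
  0 < r -> 0 < M -> 0 <= L ->
  (forall x y, a <= x <= a + L -> a <= y <= a + L ->
     Cdist (phi x) (phi y) <= M * Rabs (x - y)) ->
  (forall z, F z -> exists x, a <= x <= a + L /\ z = phi x) ->
  covered r F (M * L / r + 2).
Proof.
  intros hr hM hL hphi hF.
  assert (hq : 0 <= M * L / r).
  { apply Rdiv_le_0_compat; [| lra]. apply Rmult_le_pos; lra. }
  (* The added 1 keeps [k] positive when [L = 0]. *)
  destruct (nat_ceil (M * L / r + 1)) as [k [hk1 hk2]]; [lra |].
  assert (hkR : 1 <= INR k) by lra.
  assert (hk : (0 < k)%nat) by (apply INR_lt; simpl; lra).
  set (w := L / INR k).
  assert (hkw : INR k * w = L) by (unfold w; field; lra).
  assert (hw : M * w <= r).
  { apply Rmult_le_reg_l with (INR k); [lra |].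
    replace (INR k * (M * w)) with (M * L / r * r) by (rewrite <- hkw; field; lra).
    apply Rmult_le_compat_r; lra. }
  set (arc := fun i (z : C) => exists x,
    a <= x <= a + L /\ INR i * w <= x - a <= (INR i + 1) * w /\ z = phi x).
  assert (harc : forall i, (i < k)%nat -> covered r (arc i) 1).
  { intros i _. apply covered_small. intros z z' [x [hx [hx' ->]]] [y [hy [hy' ->]]].
    eapply Rle_trans; [apply hphi; assumption |].
    eapply Rle_trans; [| exact hw]. apply Rmult_le_compat_l; [lra |].
    apply Rabs_le; lra. }
  pose proof (covered_bigunion_const r arc 1 k harc) as h.
  eapply covered_weaken; [| | | exact h]; [lra | | lra].
  intros z hz. destruct (hF z hz) as [x [hx ->]].
  destruct (grid_index w (x - a) k hk) as [i [hi hi']]; [lra |].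
  exists i. split; [exact hi |]. exists x. repeat split; lra.
Qed.

(** A set of diameter at most [r] holds at most one of the points, so choosing for each point a set
    of the cover that contains it is injective. *)
Lemma packing (r : R) (F : C -> Prop) (P : nat -> C) (m n : nat) :
  (forall i, (i < m)%nat -> F (P i)) ->
  (forall i j, (i < j)%nat -> (j < m)%nat -> r < Cdist (P i) (P j)) ->
  has_cover r F n -> (m <= n)%nat.
Proof.
  intros hP hsep [U [hU1 hU2]].
  set (c := fun i => epsilon (inhabits 0%nat) (fun j => (j < n)%nat /\ U j (P i))).
  assert (hc : forall i, (i < m)%nat -> (c i < n)%nat /\ U (c i) (P i)).
  { intros i hi. apply (epsilon_spec (inhabits 0%nat) (fun j => (j < n)%nat /\ U j (P i))).
    apply hU2, hP, hi. }
  assert (hinj : forall i j, (i < m)%nat -> (j < m)%nat -> c i = c j -> i = j).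
  { assert (H : forall i j, (i < j)%nat -> (j < m)%nat -> c i <> c j).
    { intros i j hij hj e. destruct (hc i) as [h1 h2]; [lia |].
      destruct (hc j) as [h3 h4]; [lia |]. rewrite <- e in h4.
      pose proof (hU1 _ h1 _ _ h2 h4). pose proof (hsep i j hij hj). lra. }
    intros i j hi hj e. destruct (Nat.lt_total i j) as [h | [h | h]]; [| exact h |].
    - exfalso. now apply (H i j).
    - exfalso. now apply (H j i). }
  assert (hnd : NoDup (map c (seq 0 m))).
  { apply FinFun.Injective_map_NoDup_in; [| apply seq_NoDup].
    intros i j hi hj. apply in_seq in hi, hj. apply hinj; lia. }
  assert (hincl : incl (map c (seq 0 m)) (seq 0 n)).
  { intros x hx. apply in_map_iff in hx. destruct hx as [i [<- hi]].
    apply in_seq in hi. apply in_seq. destruct (hc i); lia. }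
  pose proof (NoDup_incl_length hnd hincl) as h.
  rewrite length_map, !length_seq in h. exact h.
Qed.

(** The pair [(j, k)] is coded as [q = j K + k]. Two indices [q < q'] then either have quotients
    [j < j'], or the same quotient and remainders [k < k']: these are the two separation
    hypotheses. *)
Lemma packing_grid (r : R) (F : C -> Prop) (P : nat -> nat -> C) (J K n : nat) :
  (forall j k, (j < J)%nat -> (k < K)%nat -> F (P j k)) ->
  (forall j j' k k', (j < j')%nat -> (j' < J)%nat -> (k < K)%nat -> (k' < K)%nat ->
     r < Cdist (P j k) (P j' k')) ->
  (forall j k k', (j < J)%nat -> (k < k')%nat -> (k' < K)%nat ->
     r < Cdist (P j k) (P j k')) ->
  has_cover r F n -> (J * K <= n)%nat.
Proof.
  intros hP h1 h2. destruct (Nat.eq_dec K 0) as [-> | hK]; [lia |].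
  apply (packing r F (fun q => P (q / K)%nat (q mod K)%nat) (J * K) n).
  - intros i hi. apply hP.
    + apply Nat.Div0.div_lt_upper_bound; lia.
    + now apply Nat.mod_upper_bound.
  - intros i i' hii' hi'.
    assert (hdJ : (i' / K < J)%nat) by (apply Nat.Div0.div_lt_upper_bound; lia).
    assert (hd : (i / K <= i' / K)%nat) by (apply Nat.Div0.div_le_mono; lia).
    pose proof (Nat.mod_upper_bound i K hK) as hm.
    pose proof (Nat.mod_upper_bound i' K hK) as hm'.
    pose proof (Nat.div_mod_eq i K) as e. pose proof (Nat.div_mod_eq i' K) as e'.
    destruct (Nat.eq_dec (i / K) (i' / K)) as [heq | hne].
    + rewrite <- heq in *. apply h2; lia.
    + apply h1; lia.
Qed.

(** As soon as one finite cover exists, a least size exists by well-ordering, so [epsilon] picks a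
    genuine minimum. *)
Lemma covering_number_spec (r : R) (F : C -> Prop) (n : nat) :
  has_cover r F n ->
  has_cover r F (covering_number r F) /\
  forall m, has_cover r F m -> (covering_number r F <= m)%nat.
Proof.
  intros h. unfold covering_number.
  apply (epsilon_spec (inhabits 0%nat) (fun n : nat => has_cover r F n /\
       forall m : nat, has_cover r F m -> (n <= m)%nat)).
  destruct (dec_inh_nat_subset_has_unique_least_element (has_cover r F)) as [k [[hk hk'] _]].
  - intros k. apply classic.
  - now exists n.
  - exists k. now split.
Qed.

Lemma covering_number_le (r : R) (F : C -> Prop) (t : R) :
  covered r F t -> INR (covering_number r F) <= t.
Proof.
  intros [n [hn hnt]]. apply Rle_trans with (INR n); [| exact hnt].
  apply le_INR. now apply (proj2 (covering_number_spec r F n hn)).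
Qed.

Lemma bounded_covered (r : R) (F : C -> Prop) :
  0 < r -> bounded F -> exists t, covered r F t.
Proof.
  intros hr [M hM]. exists (25 * (Rmax r M / r) ^ 2).
  apply covered_disc with (RtoC 0).
  - split; [exact hr | apply Rmax_l].
  - intros z hz. apply Rle_trans with M; [| apply Rmax_r].
    pose proof (Cdist_le_Cmod z (RtoC 0)) as h. rewrite Cmod_0 in h.
    specialize (hM z hz). lra.
Qed.

Lemma bounded_covering_number (r : R) (F : C -> Prop) :
  0 < r -> bounded F -> has_cover r F (covering_number r F).
Proof.
  intros hr hF. destruct (bounded_covered r F hr hF) as [t [n [hn _]]].
  apply (covering_number_spec r F n hn).
Qed.

Lemma bounded_subset (F G : C -> Prop) :
  (forall z, G z -> F z) -> bounded F -> bounded G.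
Proof. intros h [M hM]. exists M. auto. Qed.

Lemma covering_number_ge_1 (r : R) (F : C -> Prop) :
  0 < r -> bounded F -> nonempty F -> 1 <= INR (covering_number r F).
Proof.
  intros hr hF [z hz]. destruct (bounded_covering_number r F hr hF) as [U [_ hU]].
  destruct (hU z hz) as [i [hi _]]. apply (le_INR 1). lia.
Qed.

Lemma bounded_ball_in (F : C -> Prop) (x : C) (rho : R) : bounded F -> bounded (ball_in F x rho).
Proof. apply bounded_subset. now intros z [hz _]. Qed.

(** * Powers and polar coordinates *)

Lemma Rpower_pos (x y : R) : 0 < Rpower x y.
Proof. apply exp_pos. Qed.

Lemma Rpower_base_1 (y : R) : Rpower 1 y = 1.
Proof. unfold Rpower. rewrite ln_1, Rmult_0_r. apply exp_0. Qed.

Lemma ln_Rpower (x y : R) : ln (Rpower x y) = y * ln x.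
Proof. apply ln_exp. Qed.

Lemma Rpower_inv_exponent (x y : R) : 0 < x -> y <> 0 -> Rpower (Rpower x y) (/ y) = x.
Proof. intros hx hy. rewrite Rpower_mult, Rinv_r by exact hy. now apply Rpower_1. Qed.

Lemma Rpower_div (x y z : R) : 0 < x -> 0 < y -> Rpower (x / y) z = Rpower x z / Rpower y z.
Proof.
  intros hx hy. apply Rmult_eq_reg_r with (Rpower y z); [| pose proof (Rpower_pos y z); lra].
  rewrite Rpower_mult_distr; [| now apply Rdiv_lt_0_compat | exact hy].
  pose proof (Rpower_pos y z). unfold Rdiv.
  rewrite !Rmult_assoc, !Rinv_l, !Rmult_1_r; lra.
Qed.

Lemma Rpower_minus_1 (x y : R) : 0 < x -> Rpower x (y - 1) = Rpower x y / x.
Proof.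
  intros hx. unfold Rminus. rewrite Rpower_plus, Rpower_Ropp, Rpower_1 by exact hx. reflexivity.
Qed.

Lemma Rpower_antitone_base (a b c : R) :
  0 < a <= b -> c <= 0 -> Rpower b c <= Rpower a c.
Proof.
  intros hab hc. replace c with (- (- c)) by ring. rewrite !(Rpower_Ropp _ (- c)).
  apply Rinv_le_contravar; [apply Rpower_pos |]. apply Rle_Rpower_l; lra.
Qed.

Lemma Rpower_antitone_exponent (x n m : R) :
  0 < x <= 1 -> n <= m -> Rpower x m <= Rpower x n.
Proof.
  intros hx hnm. unfold Rpower. assert (h : ln x <= 0).
  { rewrite <- ln_1. apply ln_le; lra. }
  destruct (Rle_lt_or_eq_dec (m * ln x) (n * ln x)) as [h' | ->]; [nra | | lra].
  left. now apply exp_increasing.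
Qed.

Lemma Rpower_le_1 (x y : R) : 0 < x <= 1 -> 0 <= y -> Rpower x y <= 1.
Proof.
  intros hx hy. rewrite <- (Rpower_O x) by lra. now apply Rpower_antitone_exponent.
Qed.

Lemma Rpower_ge_1 (x y : R) : 1 <= x -> 0 <= y -> 1 <= Rpower x y.
Proof.
  intros hx hy. rewrite <- (Rpower_O x) by lra. now apply Rle_Rpower.
Qed.

(** Write [x^c = x x^(c-1)]; since [c >= 1], the second factor is largest at [a + b]. *)
Lemma Rpower_superadd (a b c : R) :
  0 < a -> 0 < b -> 1 <= c -> Rpower a c + Rpower b c <= Rpower (a + b) c.
Proof.
  intros ha hb hc.
  assert (e : forall x, 0 < x -> Rpower x c = x * Rpower x (c - 1)).
  { intros x hx. rewrite Rpower_minus_1 by exact hx. field. lra. }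
  rewrite !e by lra.
  assert (h1 : Rpower a (c - 1) <= Rpower (a + b) (c - 1)) by (apply Rle_Rpower_l; lra).
  assert (h2 : Rpower b (c - 1) <= Rpower (a + b) (c - 1)) by (apply Rle_Rpower_l; lra).
  nra.
Qed.

Lemma Rpower_MVT (x y c : R) :
  0 < x -> x < y -> exists t, x < t < y /\
    Rpower y c - Rpower x c = c * Rpower t (c - 1) * (y - x).
Proof.
  intros hx hxy.
  destruct (MVT_cor2 (fun t => Rpower t c) (fun t => c * Rpower t (c - 1)) x y hxy)
    as [t [h1 h2]].
  - intros t ht. apply derivable_pt_lim_power. lra.
  - exists t. now split.
Qed.

Lemma Rpower_neg_diff (x y p : R) :
  0 < x -> x <= y -> 0 < p ->
  p * Rpower y (- p - 1) * (y - x) <= Rpower x (- p) - Rpower y (- p)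
    <= p * Rpower x (- p - 1) * (y - x).
Proof.
  intros hx [hxy | <-] hp; [| lra].
  destruct (Rpower_MVT x y (- p) hx hxy) as [t [ht e]].
  replace (Rpower x (- p) - Rpower y (- p)) with (p * Rpower t (- p - 1) * (y - x)) by lra.
  assert (h1 : Rpower y (- p - 1) <= Rpower t (- p - 1))
    by (apply Rpower_antitone_base; lra).
  assert (h2 : Rpower t (- p - 1) <= Rpower x (- p - 1))
    by (apply Rpower_antitone_base; lra).
  split; apply Rmult_le_compat_r; try lra; apply Rmult_le_compat_l; lra.
Qed.

Lemma Rpower_diff_le (x y c : R) :
  0 < x -> x <= y -> y <= 1 -> 1 <= c -> Rpower y c - Rpower x c <= c * (y - x).
Proof.
  intros hx [hxy | <-] hy hc; [| lra].
  destruct (Rpower_MVT x y c hx hxy) as [t [ht e]]. rewrite e.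
  apply Rmult_le_compat_r; [lra |].
  assert (h : Rpower t (c - 1) <= 1) by (apply Rpower_le_1; lra). nra.
Qed.

(** On [[0, 1]], which ends before [pi/3], the derivative of the sine is at least 1/2. *)
Lemma sin_ge_half (u : R) : 0 <= u <= 1 -> u / 2 <= sin u.
Proof.
  intros [[hu | <-] hu1]; [| rewrite sin_0; lra].
  destruct (MVT_cor2 sin cos 0 u hu) as [c [e hc]].
  - intros t _. apply derivable_pt_lim_sin.
  - rewrite sin_0, !Rminus_0_r in e. rewrite e.
    assert (h : 1 / 2 <= cos c).
    { rewrite <- cos_PI3. pose proof PI2_3_2. apply cos_decr_1; lra. }
    nra.
Qed.

Lemma Rabs_sin_le (u : R) : Rabs (sin u) <= Rabs u.
Proof.
  destruct (Rtotal_order u 0) as [h | [-> | h]].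
  - pose proof (sin_gt_x u h) as h1.
    pose proof (sin_lt_x (- u)) as h2. rewrite sin_neg in h2.
    rewrite (Rabs_left u h). apply Rabs_le.
    destruct (Rle_lt_dec (-1) u) as [h3 | h3].
    + assert (0 <= sin (- u)) by (apply sin_ge_0; pose proof PI2_3_2; lra).
      rewrite sin_neg in *. lra.
    + pose proof (SIN_bound u). lra.
  - rewrite sin_0. lra.
  - pose proof (sin_lt_x u h) as h1.
    rewrite (Rabs_right u) by lra. apply Rabs_le.
    destruct (Rle_lt_dec u 1) as [h3 | h3].
    + assert (0 <= sin u) by (apply sin_ge_0; pose proof PI2_3_2; lra). lra.
    + pose proof (SIN_bound u). lra.
Qed.

Definition polar (a x : R) : C := Cmult (RtoC a) (cos x, sin x).

(** The law of cosines with [1 - cos] written through the half angle. For radii of one sign the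
    radial and the angular term are both nonnegative, so either alone bounds the distance from
    below. *)
Lemma Cdist_polar_sqr (a b x y : R) :
  Cdist (polar a x) (polar b y) ^ 2 = (a - b) ^ 2 + 4 * a * b * sin ((x - y) / 2) ^ 2.
Proof.
  unfold Cdist, Cmod, polar, Cminus, Cplus, Copp, Cmult, RtoC; cbn [fst snd].
  rewrite pow2_sqrt by (apply Rplus_le_le_0_compat; apply pow2_ge_0).
  pose proof (cos_2a_sin ((x - y) / 2)) as h.
  replace (2 * ((x - y) / 2)) with (x - y) in h by field.
  rewrite cos_minus in h.
  pose proof (sin2_cos2 x) as hx. pose proof (sin2_cos2 y) as hy. unfold Rsqr in *.
  transitivity (a ^ 2 * (sin x * sin x + cos x * cos x) + b ^ 2 * (sin y * sin y + cos y * cos y)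
    - 2 * a * b * (cos x * cos y + sin x * sin y)); [ring |].
  rewrite hx, hy, h. ring.
Qed.

Lemma Cmod_polar (a x : R) : 0 <= a -> Cmod (polar a x) = a.
Proof.
  intros ha. unfold polar. rewrite Cmod_mult, Cmod_R, (Rabs_pos_eq a ha).
  unfold Cmod; cbn [fst snd]. pose proof (sin2_cos2 x) as hx. unfold Rsqr in hx.
  replace (cos x ^ 2 + sin x ^ 2) with 1 by nra. rewrite sqrt_1. ring.
Qed.

(** The path changes the radius from [a] to [b] at angle [x], then follows a chord of the circle of
    radius [b]. *)
Lemma Cdist_polar_le (a b x y : R) :
  0 <= a -> 0 <= b ->
  Cdist (polar a x) (polar b y) <= Rabs (a - b) + 2 * b * Rabs (sin ((x - y) / 2)).
Proof.
  intros ha hb.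
  assert (h1 : Cdist (polar a x) (polar b x) = Rabs (a - b)).
  { rewrite <- (Rabs_pos_eq (Cdist _ _)) by apply Cdist_ge_0. apply Rsqr_eq_abs_0.
    rewrite !Rsqr_pow2, Cdist_polar_sqr, Rminus_diag, Rdiv_0_l, sin_0. ring. }
  assert (h2 : Cdist (polar b x) (polar b y) = 2 * b * Rabs (sin ((x - y) / 2))).
  { rewrite <- (Rabs_pos_eq (2 * b)), <- Rabs_mult by lra.
    rewrite <- (Rabs_pos_eq (Cdist _ _)) by apply Cdist_ge_0. apply Rsqr_eq_abs_0.
    rewrite !Rsqr_pow2, Cdist_polar_sqr. ring. }
  rewrite <- h1, <- h2. apply Cdist_triangle.
Qed.

Definition spiral_at (p x : R) : C := polar (Rpower x (- p)) x.

Lemma Cmod_spiral_at (p x : R) : Cmod (spiral_at p x) = Rpower x (- p).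
Proof. apply Cmod_polar. left. apply Rpower_pos. Qed.

Lemma spiral_spiral_at (p x : R) : 1 < x -> spiral p (spiral_at p x).
Proof. intros hx. now exists x. Qed.

Lemma spiral_at_upper (p x y : R) :
  0 < p -> 0 < x -> x <= y ->
  Cdist (spiral_at p x) (spiral_at p y) <= (p * Rpower x (- p - 1) + Rpower x (- p)) * (y - x).
Proof.
  intros hp hx hxy.
  pose proof (Rpower_pos x (- p)) as h1. pose proof (Rpower_pos y (- p)) as h2.
  assert (h3 : Rpower y (- p) <= Rpower x (- p)) by (apply Rpower_antitone_base; lra).
  eapply Rle_trans; [apply Cdist_polar_le; lra |].
  pose proof (Rabs_sin_le ((x - y) / 2)) as h4.
  rewrite (Rabs_left1 ((x - y) / 2)) in h4 by lra.
  rewrite Rabs_pos_eq by lra.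
  pose proof (proj2 (Rpower_neg_diff x y p hx hxy hp)).
  pose proof (Rabs_pos (sin ((x - y) / 2))). nra.
Qed.

(** Only the angular term is kept. Within one radian [y <= 2 x], so the radius falls at most by the
    factor [2^(-p)], and the sine of the half angle is at least [(y - x)/4]. *)
Lemma spiral_at_lower (p x y : R) :
  0 < p -> 1 <= x -> x <= y <= x + 1 ->
  Rpower 2 (- p) * Rpower x (- p) * (y - x) / 2 <= Cdist (spiral_at p x) (spiral_at p y).
Proof.
  intros hp hx hxy.
  assert (h : Rpower 2 (- p) * Rpower x (- p) <= Rpower y (- p)).
  { rewrite Rpower_mult_distr by lra. apply Rpower_antitone_base; lra. }
  set (a := Rpower x (- p)) in *. set (b := Rpower y (- p)) in *. set (c := Rpower 2 (- p)) in *.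
  pose proof (Rpower_pos x (- p)) as ha. fold a in ha.
  pose proof (Rpower_pos 2 (- p)) as hc. fold c in hc.
  assert (hc1 : c <= 1).
  { unfold c. rewrite <- (Rpower_base_1 (- p)). apply Rpower_antitone_base; lra. }
  apply Rsqr_incr_0_var; [| apply Cdist_ge_0].
  rewrite !Rsqr_pow2. unfold spiral_at. fold a b. rewrite Cdist_polar_sqr.
  replace (sin ((x - y) / 2) ^ 2) with (sin ((y - x) / 2) ^ 2)
    by (replace ((x - y) / 2) with (- ((y - x) / 2)) by field; rewrite sin_neg; ring).
  assert (hs : (y - x) / 4 <= sin ((y - x) / 2)).
  { pose proof (sin_ge_half ((y - x) / 2)). lra. }
  set (s := sin ((y - x) / 2)) in *. set (d := y - x) in *.
  assert (hd : 0 <= d) by (unfold d; lra).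
  assert (h5 : d * d / 16 <= s ^ 2) by nra.
  assert (h6 : (c * a) * (c * a) <= a * b).
  { apply Rmult_le_compat; try nra. }
  pose proof (pow2_ge_0 (a - b)).
  assert (0 <= c * a) by nra.
  assert (h7 : (c * a) * (c * a) * (d * d / 16) <= a * b * s ^ 2).
  { apply Rmult_le_compat; nra. }
  nra.
Qed.

(** * The extremal map *)

Lemma holder_continuous_within (gamma : R) (X : C -> Prop) (f : C -> C) :
  0 < gamma -> holder_map gamma X f -> continuous_within X f.
Proof.
  intros hg [K [hK hf]] x hx P [eps heps].
  pose proof (cond_pos eps) as he.
  (* Neighbourhoods in the plane are given by squares, so the distance of [y] from [x] can approach
     [2 d]; hence the outer half. The 2 in [eps / (2 * K)] makes the final inequality strict. *)
  set (d := Rpower (eps / (2 * K)) (/ gamma) / 2).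
  assert (hd : 0 < d) by (unfold d; pose proof (Rpower_pos (eps / (2 * K)) (/ gamma)); lra).
  exists (mkposreal d hd). intros y [hy1 hy2] hXy. apply heps.
  apply C_NormedModule_mixin_compat1.
  change (Cdist (f y) (f x) < eps).
  destruct (classic (y = x)) as [-> | hne]; [rewrite Cdist_refl; exact he |].
  apply Rle_lt_trans with (eps / 2); [| lra].
  eapply Rle_trans; [now apply hf |].
  assert (h : Cdist y x <= Rpower (eps / (2 * K)) (/ gamma)).
  { eapply Rle_trans; [apply Cdist_le_coords |].
    change (Rabs (fst y - fst x) < d) in hy1. change (Rabs (snd y - snd x) < d) in hy2.
    unfold d in *. lra. }
  apply Rle_trans with (K * (eps / (2 * K))); [| right; field; lra].
  apply Rmult_le_compat_l; [lra |].
  assert (hq : 0 < eps / (2 * K)) by (apply Rdiv_lt_0_compat; lra).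
  rewrite <- (Rpower_1 (eps / (2 * K))) by exact hq.
  replace 1 with (/ gamma * gamma) by (field; lra).
  rewrite <- Rpower_mult. apply Rle_Rpower_l; [lra |]. split; [now apply Cdist_gt_0 | exact h].
Qed.

(* [t^beta e^(i t^(-beta/p))], the point of the spiral at [x = t^(-beta/p)]. *)
Definition winding (p beta t : R) : C := polar (Rpower t beta) (Rpower t (- (beta / p))).

Lemma Cmod_winding (p beta t : R) : Cmod (winding p beta t) = Rpower t beta.
Proof. apply Cmod_polar. left. apply Rpower_pos. Qed.

Lemma winding_lower (p beta t u : R) :
  1 <= beta -> 0 < t -> t < u ->
  Rpower (u - t) beta <= Cdist (winding p beta t) (winding p beta u).
Proof.
  intros hb ht htu. pose proof (Rabs_Cmod_minus (winding p beta t) (winding p beta u)) as h.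
  rewrite !Cmod_winding in h.
  pose proof (Rpower_superadd t (u - t) beta ht) as h'.
  replace (t + (u - t)) with u in h' by ring.
  apply Rabs_le_between in h. lra.
Qed.

Lemma winding_upper (p beta alpha t u : R) :
  0 < p -> 1 <= beta -> 0 < alpha <= 1 -> alpha <= p * beta / (p + beta) ->
  0 < t -> t < u -> u < 1 ->
  Cdist (winding p beta t) (winding p beta u) <=
  (beta + 2 * Rmax 1 (beta / p)) * Rpower (u - t) alpha.
Proof.
  intros hp hb ha hab ht htu hu.
  set (s := beta / p). assert (hs : 0 < s) by (apply Rdiv_lt_0_compat; lra).
  (* This is the hypothesis in the form used below: [t^beta <= T^alpha] with [T = t^(s+1)]. Up to
     the factor [s], [T] is the parameter length of one radian near [t]. *)
  assert (has : alpha * (s + 1) <= beta).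
  { unfold s. replace (beta / p + 1) with ((p + beta) / p) by (field; lra).
    apply Rle_trans with (p * beta / (p + beta) * ((p + beta) / p)).
    - apply Rmult_le_compat_r; [| exact hab]. left. apply Rdiv_lt_0_compat; lra.
    - right. field. lra. }
  set (d := u - t). assert (hd : 0 < d < 1) by (unfold d; lra).
  (* The swap puts the chord on the inner circle, of radius [t^beta], to match the scale [T] built
     from [t]. *)
  rewrite Cdist_sym. eapply Rle_trans.
  { apply Cdist_polar_le; left; apply Rpower_pos. }
  fold s. rewrite Rmult_plus_distr_r. apply Rplus_le_compat.
  - assert (h1 : Rpower t beta <= Rpower u beta) by (apply Rle_Rpower_l; lra).
    rewrite Rabs_pos_eq by lra.
    eapply Rle_trans; [apply Rpower_diff_le; lra |]. fold d.
    apply Rmult_le_compat_l; [lra |]. rewrite <- (Rpower_1 d) at 1 by lra.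
    apply Rpower_antitone_exponent; lra.
  - set (T := Rpower t (s + 1)). assert (hT : 0 < T) by apply Rpower_pos.
    (* For [d <= T] the turning angle bounds the chord; for [d > T] the trivial bound 1 is enough. *)
    assert (hsin : Rabs (sin ((Rpower u (- s) - Rpower t (- s)) / 2)) <=
                   Rmax 1 s * Rpower (d / T) alpha).
    { assert (hq : 0 < d / T) by (apply Rdiv_lt_0_compat; lra).
      pose proof (Rpower_pos (d / T) alpha) as hqa.
      pose proof (Rmax_l 1 s) as hm1. pose proof (Rmax_r 1 s) as hm2.
      destruct (Rle_lt_dec (d / T) 1) as [hle | hgt].
      - eapply Rle_trans; [apply Rabs_sin_le |].
        pose proof (proj2 (Rpower_neg_diff t u s ht (Rlt_le _ _ htu) hs)) as h2.
        fold d in h2. replace (Rpower t (- s - 1)) with (/ T) in h2.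
        2:{ unfold T. rewrite <- Rpower_Ropp. f_equal. ring. }
        replace (s * / T * d) with (s * (d / T)) in h2 by (field; lra).
        assert (h3 : Rpower u (- s) <= Rpower t (- s)) by (apply Rpower_antitone_base; lra).
        rewrite Rabs_left1 by lra.
        assert (h4 : d / T <= Rpower (d / T) alpha).
        { rewrite <- (Rpower_1 (d / T)) at 1 by lra. apply Rpower_antitone_exponent; lra. }
        apply Rle_trans with (s * (d / T)); [nra |]. apply Rmult_le_compat; lra.
      - apply Rle_trans with 1.
        + apply Rabs_le, SIN_bound.
        + pose proof (Rpower_ge_1 (d / T) alpha). nra. }
    apply Rle_trans with (2 * Rpower t beta * (Rmax 1 s * Rpower (d / T) alpha)).
    { apply Rmult_le_compat_l; [| exact hsin]. pose proof (Rpower_pos t beta). lra. }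
    rewrite Rpower_div by lra. unfold T. rewrite Rpower_mult.
    assert (h5 : Rpower t beta <= Rpower t ((s + 1) * alpha))
      by (apply Rpower_antitone_exponent; lra).
    pose proof (Rpower_pos t ((s + 1) * alpha)) as h6. pose proof (Rpower_pos d alpha) as h7.
    pose proof (Rmax_l 1 s) as hm1.
    set (W := Rpower t ((s + 1) * alpha)) in *.
    replace (2 * Rpower t beta * (Rmax 1 s * (Rpower d alpha / W)))
      with (2 * Rmax 1 s * Rpower d alpha * (Rpower t beta / W)) by (field; lra).
    rewrite <- (Rmult_1_r (2 * Rmax 1 s * Rpower d alpha)) at 2.
    apply Rmult_le_compat_l.
    + apply Rmult_le_pos; lra.
    + apply Rmult_le_reg_r with W; [lra |]. field_simplify; lra.
Qed.

Lemma winding_exponent_exists (p beta alpha : R) :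
  0 < p -> 1 <= beta -> 0 < alpha <= 1 -> alpha <= p * beta / (p + beta) ->
  winding_exponent p beta alpha.
Proof.
  intros hp hb ha hab. split; [exact ha |].
  set (K := beta + 2 * Rmax 1 (beta / p)).
  assert (hK : 1 <= K) by (unfold K; pose proof (Rmax_l 1 (beta / p)); lra).
  set (f := fun z : C => winding p beta (fst z)).
  assert (hlow : forall x y, unit_interval x -> unit_interval y -> x <> y ->
    Rpower (Cdist x y) beta <= Cdist (f x) (f y)).
  { intros x y [t [ht ->]] [u [hu ->]] hne. unfold f. cbn [fst RtoC].
    rewrite Cdist_R. destruct (Rtotal_order t u) as [h | [-> | h]].
    - rewrite Rabs_left by lra. replace (- (t - u)) with (u - t) by ring.
      apply winding_lower; lra.
    - now contradiction hne.
    - rewrite Rabs_right by lra. rewrite Cdist_sym. apply winding_lower; lra. }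
  assert (hup : forall x y, unit_interval x -> unit_interval y -> x <> y ->
    Cdist (f x) (f y) <= K * Rpower (Cdist x y) alpha).
  { intros x y [t [ht ->]] [u [hu ->]] hne. unfold f. cbn [fst RtoC].
    rewrite Cdist_R. destruct (Rtotal_order t u) as [h | [-> | h]].
    - rewrite Rabs_left by lra. replace (- (t - u)) with (u - t) by ring.
      apply winding_upper; lra.
    - now contradiction hne.
    - rewrite Rabs_right by lra. rewrite Cdist_sym. apply winding_upper; lra. }
  (* The parameter is recovered from the modulus [t^beta] alone. *)
  set (g := fun z : C => RtoC (Rpower (Cmod z) (/ beta))).
  assert (hgf : forall x, unit_interval x -> g (f x) = x).
  { intros x [t [ht ->]]. unfold g, f, RtoC; cbn [fst]. rewrite Cmod_winding.
    rewrite Rpower_inv_exponent; lra || reflexivity. }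
  assert (hpre : forall y, spiral p y -> exists x, unit_interval x /\ f x = y).
  { intros y [x [hx ->]].
    exists (RtoC (Rpower x (- p / beta))). split.
    - exists (Rpower x (- p / beta)). split; [| reflexivity]. split; [apply Rpower_pos |].
      rewrite <- (Rpower_O x) by lra. apply Rpower_lt; [exact hx |].
      assert (0 < p / beta) by (apply Rdiv_lt_0_compat; lra). lra.
    - unfold f, winding, polar, RtoC; cbn [fst]. rewrite !Rpower_mult.
      replace (- p / beta * - (beta / p)) with 1 by (field; lra).
      replace (- p / beta * beta) with (- p) by (field; lra).
      rewrite Rpower_1 by lra. reflexivity. }
  exists f. split; [split; [| split] |].
  - intros x [t [ht ->]]. exists (Rpower t (- (beta / p))). split.
    + rewrite <- (Rpower_O t) by lra. unfold Rpower. apply exp_increasing.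
      assert (0 < beta / p) by (apply Rdiv_lt_0_compat; lra).
      assert (ln t < 0) by (rewrite <- ln_1; apply ln_increasing; lra). nra.
    + unfold f, winding, polar, RtoC; cbn [fst]. rewrite Rpower_mult.
      replace (- (beta / p) * - p) with beta by (field; lra). reflexivity.
  - apply (holder_continuous_within alpha); [lra |]. exists K. split; [lra | exact hup].
  - exists g. split; [| split; [| split]].
    + intros y hy. destruct (hpre y hy) as [x [hx <-]]. now rewrite hgf.
    (* The lower Hölder bound of [f] is a Hölder bound of exponent [1/beta] for its inverse. *)
    + apply (holder_continuous_within (/ beta)); [apply Rinv_0_lt_compat; lra |].
      exists 1. split; [lra |]. intros y y' hy hy' hne. rewrite Rmult_1_l.
      destruct (hpre y hy) as [x [hx <-]]. destruct (hpre y' hy') as [x' [hx' <-]].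
      rewrite !hgf by assumption.
      assert (hxx : x <> x') by (intros ->; now apply hne).
      rewrite <- (Rpower_inv_exponent (Cdist x x') beta) at 1; [| now apply Cdist_gt_0 | lra].
      apply Rle_Rpower_l; [left; apply Rinv_0_lt_compat; lra |].
      split; [apply Rpower_pos | now apply hlow].
    + exact hgf.
    + intros y hy. destruct (hpre y hy) as [x [hx <-]]. now rewrite hgf.
  - exists K. split; [lra |]. intros x y hx hy hne. split; [| now apply hup].
    eapply Rle_trans; [| now apply hlow].
    rewrite <- (Rmult_1_l (Rpower _ _)) at 2. apply Rmult_le_compat_r.
    + left; apply Rpower_pos.
    + rewrite <- Rinv_1. apply Rinv_le_contravar; lra.
Qed.

(** * The upper bound on the exponent *)

(** Turns an estimate valid for all [k] into an inequality between exponents, whatever the constants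
    are. *)
Lemma Rpower_nat_bounded_exponent (e M : R) :
  (forall k : nat, (0 < k)%nat -> Rpower (INR k) e <= M) -> e <= 0.
Proof.
  intros h. destruct (Rle_lt_dec e 0) as [he | he]; [exact he | exfalso].
  assert (hM : 1 <= M).
  { specialize (h 1%nat ltac:(lia)). simpl in h. now rewrite Rpower_base_1 in h. }
  destruct (nat_ceil (Rpower (M + 1) (/ e))) as [k [hk _]].
  { left. apply Rpower_pos. }
  pose proof (Rpower_pos (M + 1) (/ e)) as h0.
  assert (hk0 : (0 < k)%nat) by (apply INR_lt; simpl; lra).
  specialize (h k hk0).
  assert (h1 : Rpower (Rpower (M + 1) (/ e)) e <= Rpower (INR k) e)
    by (apply Rle_Rpower_l; lra).
  rewrite Rpower_mult, Rinv_l, Rpower_1 in h1 by lra. lra.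
Qed.

(** A value strictly between [max (h a, h c)] and [h b] would be taken on both sides of [b]. *)
Lemma injective_no_peak (h : R -> R) (a b c : R) :
  a < b -> b < c ->
  (forall x, a <= x <= c -> continuity_pt h x) ->
  (forall x y, a <= x <= c -> a <= y <= c -> h x = h y -> x = y) ->
  ~ (h a < h b /\ h c < h b).
Proof.
  intros hab hbc hcont hinj [h1 h2].
  set (v := (Rmax (h a) (h c) + h b) / 2).
  assert (hv : h a < v /\ h c < v /\ v < h b).
  { unfold v, Rmax. destruct (Rle_dec (h a) (h c)); lra. }
  destruct (Ranalysis5.IVT_interv (fun x => h x - v) a b) as [z1 [hz1 e1]]; try lra.
  { intros x hx. apply continuity_pt_minus; [apply hcont; lra |].
    apply continuity_pt_const. now intros ? ?. }
  destruct (Ranalysis5.IVT_interv (fun x => v - h x) b c) as [z2 [hz2 e2]]; try lra.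
  { intros x hx. apply continuity_pt_minus; [| apply hcont; lra].
    apply continuity_pt_const. now intros ? ?. }
  assert (z1 = z2) by (apply hinj; lra).
  assert (z1 = b) by lra. subst. lra.
Qed.

(** Without a peak or, applying the same to [- h], a valley at [b], the value [h b] lies between the
    other two. This is the three-point form of monotonicity. *)
Lemma injective_between (h : R -> R) (a b c : R) :
  a < b -> b < c ->
  (forall x, a <= x <= c -> continuity_pt h x) ->
  (forall x y, a <= x <= c -> a <= y <= c -> h x = h y -> x = y) ->
  Rabs (h a - h c) = Rabs (h a - h b) + Rabs (h b - h c).
Proof.
  intros hab hbc hcont hinj.
  pose proof (injective_no_peak h a b c hab hbc hcont hinj) as h1.
  assert (h2 : ~ (- h a < - h b /\ - h c < - h b)).
  { apply (injective_no_peak (fun x => - h x) a b c hab hbc).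
    - intros x hx. now apply continuity_pt_opp, hcont.
    - intros x y hx hy e. apply hinj; lra. }
  assert (hne : h a <> h b) by (intros e; apply hinj in e; lra).
  assert (hne' : h c <> h b) by (intros e; apply hinj in e; lra).
  destruct (Rle_lt_dec (h a) (h b)).
  - assert (h b <= h c) by (apply Rnot_lt_le; intros h3; apply h1; lra).
    rewrite !Rabs_left1 by lra. ring.
  - assert (h c <= h b) by (apply Rnot_lt_le; intros h3; apply h2; lra).
    rewrite !Rabs_right by lra. ring.
Qed.

(** The images of consecutive steps are adjacent intervals, so their lengths add; the induction
    inserts one point between the ends at a time. *)
Lemma injective_steps_add (h : R -> R) (A m : R) (x : nat -> R) (n : nat) :
  (forall t, A < t -> continuity_pt h t) ->
  (forall s t, A < s -> A < t -> h s = h t -> s = t) ->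
  A < x 0%nat -> (forall i, x i < x (S i)) ->
  (forall i, (i < n)%nat -> m <= Rabs (h (x i) - h (x (S i)))) ->
  INR n * m <= Rabs (h (x 0%nat) - h (x n)).
Proof.
  intros hcont hinj hA hx hm.
  assert (hx0 : forall i, x 0%nat <= x i).
  { intros i. induction i as [| i IH]; [lra |]. specialize (hx i). lra. }
  induction n as [| n IH].
  - simpl. rewrite Rmult_0_l. apply Rabs_pos.
  - rewrite S_INR. specialize (hm n ltac:(lia)) as hmn.
    assert (h1 : INR n * m <= Rabs (h (x 0%nat) - h (x n))) by (apply IH; intros; apply hm; lia).
    (* With a single step the middle point would be [x 0] itself, and betweenness requires three
       distinct points. *)
    destruct n as [| n].
    + simpl. lra.
    + rewrite (injective_between h (x 0%nat) (x (S n)) (x (S (S n)))).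
      * lra.
      * specialize (hx n). specialize (hx0 n). lra.
      * apply hx.
      * intros t ht. apply hcont. lra.
      * intros s t hs ht. apply hinj; lra.
Qed.

Lemma spiral_at_inj (p x y : R) :
  0 < p -> 0 < x -> 0 < y -> spiral_at p x = spiral_at p y -> x = y.
Proof.
  intros hp hx hy e. assert (h : Rpower x (- p) = Rpower y (- p)).
  { now rewrite <- !Cmod_spiral_at, e. }
  rewrite <- (Rpower_inv_exponent x (- p)), <- (Rpower_inv_exponent y (- p)) by lra.
  now rewrite h.
Qed.

(** After half a turn the two points lie on opposite rays, so their distance is the sum of their
    radii. *)
Lemma spiral_at_opposite (p x : R) :
  Cdist (spiral_at p x) (spiral_at p (x + PI)) = Rpower x (- p) + Rpower (x + PI) (- p).
Proof.
  pose proof (Rpower_pos x (- p)) as h1. pose proof (Rpower_pos (x + PI) (- p)) as h2.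
  rewrite <- (Rabs_pos_eq (Cdist _ _)) by apply Cdist_ge_0.
  rewrite <- (Rabs_pos_eq (Rpower x (- p) + _)) by lra. apply Rsqr_eq_abs_0.
  rewrite !Rsqr_pow2. unfold spiral_at. rewrite Cdist_polar_sqr.
  replace ((x - (x + PI)) / 2) with (- (PI / 2)) by field.
  rewrite sin_neg, sin_PI2. ring.
Qed.

Lemma continuity_pt_of_modulus (h : R -> R) (x d M gamma : R) :
  0 < gamma -> 0 < d -> 0 < M ->
  (forall y, Rabs (y - x) < d -> y <> x -> Rabs (h y - h x) <= M * Rpower (Rabs (y - x)) gamma) ->
  continuity_pt h x.
Proof.
  intros hg hd hM H eps he.
  set (q := eps / (2 * M)). assert (hq : 0 < q) by (apply Rdiv_lt_0_compat; lra).
  exists (Rmin d (Rpower q (/ gamma))). split.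
  - apply Rmin_pos; [exact hd | apply Rpower_pos].
  - intros y [[_ hne] hy]. change (Rabs (h y - h x) < eps).
    change (Rabs (y - x) < Rmin d (Rpower q (/ gamma))) in hy.
    pose proof (Rmin_l d (Rpower q (/ gamma))). pose proof (Rmin_r d (Rpower q (/ gamma))).
    assert (h0 : 0 < Rabs (y - x)) by (apply Rabs_pos_lt; intros e; apply hne; lra).
    eapply Rle_lt_trans; [apply H; [lra | congruence] |].
    apply Rle_lt_trans with (M * q); [| unfold q; field_simplify; lra].
    apply Rmult_le_compat_l; [lra |].
    rewrite <- (Rpower_1 q) by exact hq. replace 1 with (/ gamma * gamma) by (field; lra).
    rewrite <- Rpower_mult. apply Rle_Rpower_l; lra.
Qed.

Lemma winding_exponent_le (p beta alpha : R) :
  0 < p -> 1 <= beta -> winding_exponent p beta alpha -> alpha <= p * beta / (p + beta).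
Proof.
  intros hp hb [ha [f [[_ [_ [g [hgI [_ [_ hfg]]]]]] [K [hK hf]]]]].
  (* The inverse homeomorphism read along the angle, as a real function on [(1, oo)]. *)
  set (h := fun x => fst (g (spiral_at p x))).
  assert (hgh : forall x, 1 < x -> g (spiral_at p x) = RtoC (h x)).
  { intros x hx. destruct (hgI _ (spiral_spiral_at p x hx)) as [t [_ ht]].
    unfold h. now rewrite ht. }
  assert (hinj : forall x y, 1 < x -> 1 < y -> h x = h y -> x = y).
  { intros x y hx hy e. apply (spiral_at_inj p); [lra | lra | lra |].
    rewrite <- (hfg (spiral_at p x)), <- (hfg (spiral_at p y)), !hgh, e;
      auto using spiral_spiral_at. }
  assert (hh : forall x y, 1 < x -> 1 < y -> x <> y ->
    Rpower (Rabs (h x - h y)) beta <= K * Cdist (spiral_at p x) (spiral_at p y) /\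
    Cdist (spiral_at p x) (spiral_at p y) <= K * Rpower (Rabs (h x - h y)) alpha).
  { intros x y hx hy hne.
    assert (hne' : g (spiral_at p x) <> g (spiral_at p y)).
    { rewrite !hgh by assumption. intros e. apply hne, hinj; [exact hx | exact hy |].
      exact (f_equal fst e). }
    destruct (hf _ _ (hgI _ (spiral_spiral_at p x hx)) (hgI _ (spiral_spiral_at p y hy)) hne')
      as [h1 h2].
    rewrite !hfg, !hgh, Cdist_R in * by auto using spiral_spiral_at.
    split; [| exact h2]. apply Rmult_le_reg_l with (/ K); [now apply Rinv_0_lt_compat |].
    eapply Rle_trans; [exact h1 |]. right. field. lra. }
  assert (hpos : forall x y, 1 < x -> 1 < y -> x <> y -> 0 < Rabs (h x - h y)).
  { intros x y hx hy hne. apply Rabs_pos_lt. intros e. apply hne, hinj; lra. }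
  assert (hdown : forall x y, 1 < x -> 1 < y -> x <> y ->
    Rabs (h x - h y) <= Rpower (K * Cdist (spiral_at p x) (spiral_at p y)) (/ beta)).
  { intros x y hx hy hne.
    rewrite <- (Rpower_inv_exponent (Rabs (h x - h y)) beta) at 1 by (auto || lra).
    apply Rle_Rpower_l; [left; apply Rinv_0_lt_compat; lra |].
    split; [apply Rpower_pos | now apply hh]. }
  (* The inverse is Hölder of exponent [1/beta] by [hdown], and the spiral is Lipschitz in its angle
     with constant [p + 1] because all powers [s^(-c)] with [s > 1], [c >= 0] are at most 1. *)
  assert (hcont : forall x, 1 < x -> continuity_pt h x).
  { intros x hx. set (L := p + 1). assert (hL : 1 <= L) by (unfold L; lra).
    apply continuity_pt_of_modulus with (d := x - 1) (M := Rpower (K * L) (/ beta))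
      (gamma := / beta); [apply Rinv_0_lt_compat; lra | lra | apply Rpower_pos |].
    intros y hy hne. apply Rabs_lt_between in hy.
    assert (hKL : 0 < K * L) by (apply Rmult_lt_0_compat; lra).
    assert (hyx : 0 < Rabs (y - x)) by (apply Rabs_pos_lt; intros e; apply hne; lra).
    eapply Rle_trans; [apply hdown; [lra | lra | exact hne] |]. rewrite Rpower_mult_distr by lra.
    apply Rle_Rpower_l; [left; apply Rinv_0_lt_compat; lra |].
    rewrite Rmult_assoc.
    assert (hS : forall s t, 1 < s -> s <= t ->
      Cdist (spiral_at p s) (spiral_at p t) <= L * (t - s)).
    { intros s t hs hst. eapply Rle_trans; [apply spiral_at_upper; lra |].
      apply Rmult_le_compat_r; [lra |]. unfold L.
      assert (e : forall c, 0 <= c -> Rpower s (- c) <= 1).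
      { intros c hc. rewrite <- (Rpower_base_1 (- c)). apply Rpower_antitone_base; lra. }
      pose proof (e p). pose proof (e (p + 1)).
      replace (- p - 1) with (- (p + 1)) by ring. nra. }
    split.
    - apply Rmult_lt_0_compat; [exact hK |]. apply Cdist_gt_0. intros e.
      apply spiral_at_inj in e; lra.
    - apply Rmult_le_compat_l; [lra |]. destruct (Rle_lt_dec x y).
      + rewrite Rabs_pos_eq, Cdist_sym by lra. apply hS; lra.
      + rewrite Rabs_left by lra. replace (- (y - x)) with (x - y) by ring. apply hS; lra. }
  pose proof PI2_3_2 as hPI.
  (* [a1] comes from half-turns starting at [x <= 2 pi k], whose ends are at least [(2 pi k)^(-p)]
     apart. [b1] comes from the outermost and the innermost point, both of modulus at most
     [(pi k)^(-p)]. *)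
  set (a1 := Rpower (Rpower (2 * PI) (- p) / K) (/ alpha)).
  set (b1 := Rpower (2 * K * Rpower PI (- p)) (/ beta)).
  assert (ha1 : 0 < a1) by apply Rpower_pos.
  assert (hmain : 1 - p / alpha + p / beta <= 0).
  { apply (Rpower_nat_bounded_exponent _ (b1 / a1)). intros k hk.
    assert (hkR : 1 <= INR k) by (apply (le_INR 1); lia).
    set (m := a1 * Rpower (INR k) (- p / alpha)).
    assert (hstep : INR k * m <= Rabs (h (PI * INR k) - h (PI * INR (k + k)))).
    { pose proof (injective_steps_add h 1 m (fun i => PI * INR (k + i)) k hcont hinj) as hs.
      cbv beta in hs. rewrite Nat.add_0_r in hs. apply hs; clear hs.
      - nra.
      - intros i. rewrite !plus_INR, S_INR. nra.
      - intros i hi. set (x := PI * INR (k + i)).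
        assert (hik : INR k <= INR (k + i) <= 2 * INR k).
        { rewrite plus_INR. pose proof (pos_INR i). pose proof (le_INR i k ltac:(lia)). lra. }
        assert (hx : 1 < x <= 2 * PI * INR k) by (unfold x; nra).
        replace (PI * INR (k + S i)) with (x + PI)
          by (unfold x; rewrite !plus_INR, S_INR; ring).
        destruct (hh x (x + PI)) as [_ h2]; [lra | lra | lra |].
        rewrite spiral_at_opposite in h2.
        pose proof (Rpower_pos (x + PI) (- p)) as h3.
        assert (h4 : Rpower (2 * PI * INR k) (- p) <= Rpower x (- p))
          by (apply Rpower_antitone_base; lra).
        rewrite <- Rpower_mult_distr in h4 by lra.
        set (D := Rabs (h x - h (x + PI))) in *.
        assert (hD : 0 < D) by (apply hpos; lra).
        rewrite <- (Rpower_inv_exponent D alpha) by lra.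
        replace m with (Rpower (Rpower (2 * PI) (- p) / K * Rpower (INR k) (- p)) (/ alpha)).
        2:{ rewrite <- Rpower_mult_distr, Rpower_mult; [reflexivity | | apply Rpower_pos].
            apply Rdiv_lt_0_compat; [apply Rpower_pos | exact hK]. }
        apply Rle_Rpower_l; [left; apply Rinv_0_lt_compat; lra |]. split.
        + apply Rmult_lt_0_compat; [| apply Rpower_pos].
          apply Rdiv_lt_0_compat; [apply Rpower_pos | exact hK].
        + apply Rmult_le_reg_l with K; [exact hK |].
          replace (K * (Rpower (2 * PI) (- p) / K * Rpower (INR k) (- p)))
            with (Rpower (2 * PI) (- p) * Rpower (INR k) (- p)) by (field; lra). lra. }
    assert (hup : Rabs (h (PI * INR k) - h (PI * INR (k + k))) <= b1 * Rpower (INR k) (- p / beta)).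
    { assert (hx : 1 < PI * INR k) by nra.
      assert (hxy : PI * INR k < PI * INR (k + k)) by (rewrite plus_INR; nra).
      eapply Rle_trans; [apply hdown; lra |].
      replace (b1 * Rpower (INR k) (- p / beta))
        with (Rpower (2 * K * Rpower PI (- p) * Rpower (INR k) (- p)) (/ beta)).
      2:{ rewrite <- Rpower_mult_distr, Rpower_mult; [reflexivity | | apply Rpower_pos].
          pose proof (Rpower_pos PI (- p)). nra. }
      apply Rle_Rpower_l; [left; apply Rinv_0_lt_compat; lra |]. split.
      - apply Rmult_lt_0_compat; [exact hK |]. apply Cdist_gt_0. intros e.
        apply spiral_at_inj in e; lra.
      - rewrite Rmult_assoc, Rpower_mult_distr by lra.
        replace (2 * K * Rpower (PI * INR k) (- p))
          with (K * (Rpower (PI * INR k) (- p) + Rpower (PI * INR k) (- p))) by ring.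
        apply Rmult_le_compat_l; [lra |]. eapply Rle_trans; [apply Cdist_le_Cmod |].
        rewrite !Cmod_spiral_at. apply Rplus_le_compat_l. apply Rpower_antitone_base; lra. }
    assert (hall : INR k * m <= b1 * Rpower (INR k) (- p / beta)) by lra.
    unfold m in hall.
    set (u := Rpower (INR k) (- p / beta)) in *. assert (hu : 0 < u) by apply Rpower_pos.
    assert (e : Rpower (INR k) (1 - p / alpha + p / beta) = INR k * Rpower (INR k) (- p / alpha) / u).
    { apply Rmult_eq_reg_r with u; [| lra]. unfold u at 1. rewrite <- Rpower_plus.
      replace (1 - p / alpha + p / beta + - p / beta) with (1 + - p / alpha) by (field; lra).
      rewrite Rpower_plus, Rpower_1 by lra. field. lra. }
    rewrite e. apply Rmult_le_reg_r with (a1 * u); [apply Rmult_lt_0_compat; lra |].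
    field_simplify; lra. }
  assert (h3 : (p + beta) / beta <= p / alpha).
  { replace ((p + beta) / beta) with (1 + p / beta) by (field; lra). lra. }
  apply Rmult_le_reg_r with ((p + beta) / beta); [apply Rdiv_lt_0_compat; lra |].
  replace (p * beta / (p + beta) * ((p + beta) / beta)) with p by (field; lra).
  replace p with (alpha * (p / alpha)) at 2 by (field; lra).
  apply Rmult_le_compat_l; lra.
Qed.

(** * Dimensions under Hölder maps *)

Lemma Rpower_scale_ratio (r theta s : R) :
  0 < r -> Rpower (Rpower r theta / r) s = Rpower r ((theta - 1) * s).
Proof.
  intros hr. rewrite <- Rpower_mult. f_equal. now rewrite Rpower_minus_1.
Qed.

Lemma scale_ratio_ge_1 (r theta : R) : 0 < r < 1 -> theta <= 1 -> 1 <= Rpower r theta / r.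
Proof.
  intros hr ht. rewrite <- Rpower_minus_1 by lra. rewrite <- (Rpower_O r) at 1 by lra.
  apply Rpower_antitone_exponent; lra.
Qed.

Lemma scale_le (r theta : R) : 0 < r < 1 -> theta <= 1 -> r <= Rpower r theta.
Proof.
  intros hr ht. rewrite <- (Rpower_1 r) at 1 by lra. apply Rpower_antitone_exponent; lra.
Qed.

(** The set of exponents whose infimum is [assouad_spectrum]; the two agree by conversion. *)
Definition spectrum_exponent (theta : R) (F : C -> Prop) (s : R) : Prop :=
  exists K : R, 0 < K /\
    forall (r : R) (x : C), 0 < r < 1 -> F x ->
      INR (covering_number r (ball_in F x (Rpower r theta))) <=
      K * Rpower (Rpower r theta / r) s.

(** The two bounds together give [c <= K r^e] with [e = (1 - theta)(d - s)]. If [s < d] this fails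
    for small [r], and the [r] chosen makes [K r^e] at most [c/2]. *)
Lemma spectrum_exponent_lower (theta d c delta s : R) (F : C -> Prop) :
  0 < theta < 1 -> 0 < c -> 0 < delta ->
  (forall r, 0 < r < delta -> exists x, F x /\
     c * Rpower (Rpower r theta / r) d <=
     INR (covering_number r (ball_in F x (Rpower r theta)))) ->
  spectrum_exponent theta F s -> d <= s.
Proof.
  intros ht hc hd hlow [K [hK hs]]. apply Rnot_lt_le. intros hsd.
  set (e := (1 - theta) * (d - s)). assert (he : 0 < e) by (unfold e; nra).
  set (q := c / (2 * K)). assert (hq : 0 < q) by (apply Rdiv_lt_0_compat; lra).
  set (r := Rmin (Rmin (delta / 2) (/ 2)) (Rpower q (/ e))).
  assert (hr : 0 < r) by (apply Rmin_pos; [apply Rmin_pos; lra | apply Rpower_pos]).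
  assert (hr1 : r <= delta / 2 /\ r <= / 2 /\ r <= Rpower q (/ e)).
  { unfold r. pose proof (Rmin_l (Rmin (delta / 2) (/ 2)) (Rpower q (/ e))).
    pose proof (Rmin_r (Rmin (delta / 2) (/ 2)) (Rpower q (/ e))).
    pose proof (Rmin_l (delta / 2) (/ 2)). pose proof (Rmin_r (delta / 2) (/ 2)). lra. }
  destruct (hlow r) as [x [hx h1]]; [lra |].
  pose proof (hs r x ltac:(lra) hx) as h2. rewrite Rpower_scale_ratio in h1, h2 by lra.
  assert (h3 : Rpower r e <= q).
  { apply Rle_trans with (Rpower (Rpower q (/ e)) e).
    - apply Rle_Rpower_l; lra.
    - rewrite Rpower_mult, Rinv_l, Rpower_1; lra. }
  replace ((theta - 1) * s) with (e + (theta - 1) * d) in h2 by (unfold e; ring).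
  rewrite Rpower_plus in h2. pose proof (Rpower_pos r ((theta - 1) * d)) as h4.
  assert (h5 : K * Rpower r e <= c / 2).
  { apply Rle_trans with (K * q); [apply Rmult_le_compat_l; lra | right; unfold q; field; lra]. }
  nra.
Qed.

Lemma spectrum_exponent_ge_0 (theta s : R) (F : C -> Prop) :
  0 < theta < 1 -> nonempty F -> bounded F -> spectrum_exponent theta F s -> 0 <= s.
Proof.
  intros ht [x hx] hF. apply (spectrum_exponent_lower theta 0 1 1); [exact ht | lra | lra |].
  intros r hr. exists x. split; [exact hx |].
  rewrite Rpower_O, Rmult_1_l by (pose proof (scale_ratio_ge_1 r theta); lra).
  apply covering_number_ge_1; [lra | now apply bounded_ball_in |].
  exists x. split; [exact hx |]. rewrite Cdist_refl. left. apply Rpower_pos.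
Qed.

Lemma spectrum_exponent_2 (theta : R) (F : C -> Prop) :
  0 < theta < 1 -> spectrum_exponent theta F 2.
Proof.
  intros ht. exists 25. split; [lra |]. intros r x hr hx.
  apply covering_number_le.
  pose proof (scale_ratio_ge_1 r theta hr ltac:(lra)).
  replace 2 with (INR 2) by reflexivity. rewrite Rpower_pow by lra.
  apply covered_disc with x; [| now intros z [_ hz]].
  split; [lra | apply scale_le; lra].
Qed.

(** A lower bound and one element make the extended infimum finite, so [real] does not fall back on
    its default value 0. For spectra these are the bound 0 and the element 2. *)
Lemma Glb_Rbar_real (E : R -> Prop) (l s0 : R) :
  (forall s, E s -> l <= s) -> E s0 ->
  (forall s, E s -> real (Glb_Rbar E) <= s) /\
  (forall b, (forall s, E s -> b <= s) -> b <= real (Glb_Rbar E)).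
Proof.
  intros hl h0. destruct (Glb_Rbar_correct E) as [h1 h2].
  assert (h3 : Rbar_le l (Glb_Rbar E)) by (apply h2; intros s hs; now apply hl).
  specialize (h1 s0 h0) as h4.
  destruct (Glb_Rbar E) as [g | |]; try contradiction.
  split.
  - intros s hs. exact (h1 s hs).
  - intros b hb. apply (h2 (Finite b)). intros s hs. exact (hb s hs).
Qed.

Lemma spectrum_le (theta d : R) (F : C -> Prop) :
  0 < theta < 1 -> nonempty F -> bounded F ->
  (forall s, d < s -> spectrum_exponent theta F s) -> assouad_spectrum theta F <= d.
Proof.
  intros ht hne hF h. apply Rnot_lt_le. intros hlt.
  destruct (Glb_Rbar_real (spectrum_exponent theta F) 0 2) as [h1 _].
  - intros s. now apply spectrum_exponent_ge_0.
  - now apply spectrum_exponent_2.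
  - change (real (Glb_Rbar (spectrum_exponent theta F))) with (assouad_spectrum theta F) in h1.
    assert (h2 : spectrum_exponent theta F ((d + assouad_spectrum theta F) / 2))
      by (apply h; lra).
    specialize (h1 _ h2). lra.
Qed.

Lemma spectrum_ge (theta d : R) (F : C -> Prop) :
  0 < theta < 1 -> nonempty F -> bounded F ->
  (forall s, spectrum_exponent theta F s -> d <= s) -> d <= assouad_spectrum theta F.
Proof.
  intros ht hne hF h.
  apply (Glb_Rbar_real (spectrum_exponent theta F) 0 2); [| | exact h].
  - intros s. now apply spectrum_exponent_ge_0.
  - now apply spectrum_exponent_2.
Qed.

Lemma spectrum_le_exponent (theta s : R) (F : C -> Prop) :
  0 < theta < 1 -> nonempty F -> bounded F ->
  spectrum_exponent theta F s -> assouad_spectrum theta F <= s.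
Proof.
  intros ht hne hF h.
  apply (Glb_Rbar_real (spectrum_exponent theta F) 0 2); [| | exact h].
  - intros s'. now apply spectrum_exponent_ge_0.
  - now apply spectrum_exponent_2.
Qed.

(** The pieces are intersected with [G] before being mapped, since [f] is controlled only on [X]. *)
Lemma has_cover_image (alpha K rho r : R) (X G : C -> Prop) (f : C -> C) (n : nat) :
  0 < alpha -> 0 < K -> K * Rpower rho alpha <= r ->
  (forall x y, X x -> X y -> x <> y -> Cdist (f x) (f y) <= K * Rpower (Cdist x y) alpha) ->
  (forall x, G x -> X x) ->
  has_cover rho G n -> has_cover r (fun y => exists x, G x /\ f x = y) n.
Proof.
  intros ha hK hr hf hG [U [hU1 hU2]].
  exists (fun i y => exists x, G x /\ U i x /\ f x = y). split.
  - intros i hi _ _ [x [hx [hUx <-]]] [y [hy [hUy <-]]].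
    destruct (classic (x = y)) as [-> | hne].
    + rewrite Cdist_refl. pose proof (Rpower_pos rho alpha). nra.
    + eapply Rle_trans; [apply hf; auto |]. eapply Rle_trans; [| exact hr].
      apply Rmult_le_compat_l; [lra |]. apply Rle_Rpower_l; [lra |].
      split; [now apply Cdist_gt_0 | now apply (hU1 i)].
  - intros _ [x [hx <-]]. destruct (hU2 x hx) as [i [hi hi']].
    exists i. split; [exact hi |]. now exists x.
Qed.

Lemma spectrum_exponent_distortion (alpha beta theta s : R) (X Y : C -> Prop) (f : C -> C) :
  0 < alpha <= 1 -> 1 <= beta -> 0 < theta < 1 ->
  nonempty X -> bounded X -> bounded Y ->
  holder_homeomorphism alpha beta X Y f ->
  spectrum_exponent (alpha * theta / beta) X s ->
  spectrum_exponent theta Y ((beta - alpha * theta) / (alpha * beta * (1 - theta)) * s).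
Proof.
  intros ha hb ht hneX hX hY [[hfXY [_ [g [hg [_ [_ hfg]]]]]] [K [hK hf]]] hs.
  set (phi := alpha * theta / beta) in *.
  assert (hphi : 0 < phi < 1).
  { unfold phi. split; [apply Rdiv_lt_0_compat; nra |].
    apply Rmult_lt_reg_r with beta; [lra |]. field_simplify; nra. }
  assert (hs0 : 0 <= s) by exact (spectrum_exponent_ge_0 phi s X hphi hneX hX hs).
  destruct hs as [KX [hKX hsX]].
  set (s' := (beta - alpha * theta) / (alpha * beta * (1 - theta)) * s).
  assert (hs' : 0 <= s').
  { apply Rmult_le_pos; [| exact hs0]. apply Rdiv_le_0_compat; [nra |].
    repeat apply Rmult_lt_0_compat; lra. }
  (* The scale in [X] will be [rho = A r^(1/alpha)]. The first entry of the maximum puts the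
     preimage of the ball of radius [r^theta] into the ball of radius [rho^phi]; the second gives
     [eps <= rho] for the finer scale [eps = (r/K)^(1/alpha)]. *)
  set (A := Rmax (Rpower K (/ (alpha * theta))) (Rpower K (- / alpha))).
  assert (hA1 : Rpower K (/ (alpha * theta)) <= A) by apply Rmax_l.
  assert (hA2 : Rpower K (- / alpha) <= A) by apply Rmax_r.
  assert (hA : 0 < A) by (eapply Rlt_le_trans; [apply Rpower_pos | exact hA1]).
  (* [rho < 1] holds exactly for [r < r0]. For larger [r] one cover of [Y] at scale [r0] serves, and
     its size [t0] enters the constant. *)
  set (r0 := Rpower A (- alpha)). assert (hr0 : 0 < r0) by apply Rpower_pos.
  destruct (bounded_covered r0 Y hr0 hY) as [t0 ht0].
  set (B := KX * Rpower A ((phi - 1) * s) * (25 * (A * Rpower K (/ alpha)) ^ 2)).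
  assert (hB : 0 < B).
  { unfold B. apply Rmult_lt_0_compat.
    - apply Rmult_lt_0_compat; [exact hKX | apply Rpower_pos].
    - pose proof (Rmult_lt_0_compat _ _ hA (Rpower_pos K (/ alpha))). nra. }
  exists (B + Rabs t0). split; [pose proof (Rabs_pos t0); lra |].
  intros r y hr hy.
  pose proof (scale_ratio_ge_1 r theta hr ltac:(lra)) as hq.
  pose proof (Rpower_ge_1 _ s' hq hs') as hq'.
  rewrite Rmult_plus_distr_r.
  apply covering_number_le.
  destruct (Rle_lt_dec r0 r) as [hr0r | hrr0].
  - apply (covered_weaken r0 _ Y _ t0); [exact hr0r | now intros z [hz _] | | exact ht0].
    pose proof (Rle_abs t0). pose proof (Rabs_pos t0). nra.
  - set (rho := A * Rpower r (/ alpha)).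
    assert (hra : 0 < Rpower r (/ alpha)) by apply Rpower_pos.
    assert (hrho0 : 0 < rho) by (apply Rmult_lt_0_compat; lra).
    assert (hrho : rho < 1).
    { unfold rho. apply Rmult_lt_reg_l with (/ A); [now apply Rinv_0_lt_compat |].
      rewrite <- Rmult_assoc, Rinv_l, Rmult_1_l, Rmult_1_r by lra.
      replace (/ A) with (Rpower r0 (/ alpha)).
      - apply Rlt_Rpower_l; [apply Rinv_0_lt_compat |]; lra.
      - unfold r0. rewrite Rpower_mult. replace (- alpha * / alpha) with (- (1)) by (field; lra).
        now rewrite Rpower_Ropp, Rpower_1. }
    (* At this scale pieces in [X] have images of diameter at most [r]. The ratio [rho / eps] does
       not depend on [r], so refining costs a constant. *)
    set (eps := Rpower K (- / alpha) * Rpower r (/ alpha)).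
    assert (heps : 0 < eps) by (apply Rmult_lt_0_compat; [apply Rpower_pos | lra]).
    assert (heps' : eps <= rho) by (apply Rmult_le_compat_r; lra).
    assert (hq2 : rho / eps = A * Rpower K (/ alpha)).
    { unfold rho, eps. rewrite Rpower_Ropp. pose proof (Rpower_pos K (/ alpha)).
      field. split; lra. }
    pose proof (bounded_covering_number rho _ hrho0 (bounded_ball_in X (g y) (Rpower rho phi) hX))
      as hcov.
    pose proof (hsX rho (g y) ltac:(lra) (hg y hy)) as hN.
    set (N := covering_number rho (ball_in X (g y) (Rpower rho phi))) in *.
    pose proof (covered_refine eps rho _ N ltac:(lra) hcov) as [n [hn1 hn2]].
    rewrite hq2 in hn2.
    assert (hKe : K * Rpower eps alpha <= r).
    { unfold eps. rewrite <- Rpower_mult_distr, !Rpower_mult by (apply Rpower_pos).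
      replace (- / alpha * alpha) with (- (1)) by (field; lra).
      replace (/ alpha * alpha) with 1 by (field; lra).
      rewrite Rpower_Ropp, !Rpower_1 by lra. right. field. lra. }
    pose proof (has_cover_image alpha K eps r X _ f n ltac:(lra) hK hKe
      (fun x y hx hy h => proj2 (hf x y hx hy h)) (fun x hx => proj1 hx) hn1) as himg.
    exists n. split.
    + eapply has_cover_weaken; [apply Rle_refl | | exact himg].
      intros z [hz hzy]. exists (g z). split; [| now apply hfg].
      split; [now apply hg |].
      destruct (classic (g z = g y)) as [e | hne].
      { rewrite e, Cdist_refl. left. apply Rpower_pos. }
      destruct (hf _ _ (hg z hz) (hg y hy) hne) as [h1 _]. rewrite !hfg in h1 by assumption.
      assert (h2 : Rpower (Cdist (g z) (g y)) beta <= K * Rpower r theta).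
      { apply Rmult_le_reg_l with (/ K); [now apply Rinv_0_lt_compat |].
        rewrite <- Rmult_assoc, Rinv_l, Rmult_1_l by lra. lra. }
      rewrite <- (Rpower_inv_exponent (Cdist (g z) (g y)) beta);
        [| now apply Cdist_gt_0 | lra].
      apply Rle_trans with (Rpower (K * Rpower r theta) (/ beta)).
      * apply Rle_Rpower_l; [left; apply Rinv_0_lt_compat; lra |].
        split; [apply Rpower_pos | exact h2].
      * unfold rho. rewrite <- !Rpower_mult_distr by (lra || apply Rpower_pos).
        rewrite !Rpower_mult. unfold phi at 2.
        replace (/ alpha * (alpha * theta / beta)) with (theta * / beta) by (field; lra).
        apply Rmult_le_compat_r; [left; apply Rpower_pos |].
        replace (Rpower K (/ beta)) with (Rpower (Rpower K (/ (alpha * theta))) phi).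
        -- apply Rle_Rpower_l; [lra |]. split; [apply Rpower_pos | exact hA1].
        -- rewrite Rpower_mult. f_equal. unfold phi. field. lra.
    + eapply Rle_trans; [exact hn2 |].
      apply Rle_trans with (B * Rpower (Rpower r theta / r) s').
      2:{ pose proof (Rabs_pos t0). nra. }
      rewrite Rpower_scale_ratio in hN |- * by lra.
      unfold rho in hN. rewrite <- Rpower_mult_distr, Rpower_mult in hN by lra.
      replace (/ alpha * ((phi - 1) * s)) with ((theta - 1) * s') in hN
        by (unfold s', phi; field; lra).
      unfold B.
      replace (KX * Rpower A ((phi - 1) * s) * (25 * (A * Rpower K (/ alpha)) ^ 2) *
        Rpower r ((theta - 1) * s')) with
        (KX * (Rpower A ((phi - 1) * s) * Rpower r ((theta - 1) * s')) *
         (25 * (A * Rpower K (/ alpha)) ^ 2)) by ring.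
      apply Rmult_le_compat_r; [| exact hN].
      pose proof (pow2_ge_0 (A * Rpower K (/ alpha))). lra.
Qed.

Lemma assouad_distortion_holds : assouad_distortion.
Proof.
  intros alpha beta X Y f ha hb hneX hX hneY hY hf theta ht.
  set (c := (beta - alpha * theta) / (alpha * beta * (1 - theta))).
  assert (hc : 0 < c).
  { apply Rdiv_lt_0_compat; [nra |]. repeat apply Rmult_lt_0_compat; lra. }
  assert (hphi : 0 < alpha * theta / beta < 1).
  { split; [apply Rdiv_lt_0_compat; nra |].
    apply Rmult_lt_reg_r with beta; [lra |]. field_simplify; nra. }
  (* Divided by [c], the claim is a lower bound for an infimum over the exponents of [X], so it can
     be checked one exponent at a time. *)
  apply Rmult_le_reg_l with (/ c); [now apply Rinv_0_lt_compat |].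
  rewrite <- Rmult_assoc, Rinv_l, Rmult_1_l by lra.
  apply spectrum_ge; [exact hphi | exact hneX | exact hX |].
  intros s hs. apply Rmult_le_reg_l with c; [exact hc |].
  rewrite <- Rmult_assoc, Rinv_r, Rmult_1_l by lra.
  apply spectrum_le_exponent; [exact ht | exact hneY | exact hY |].
  exact (spectrum_exponent_distortion alpha beta theta s X Y f ha hb ht hneX hX hY hf hs).
Qed.

Lemma at_right_0_intro (P : R -> Prop) (delta : R) :
  0 < delta -> (forall r, 0 < r < delta -> P r) -> at_right 0 P.
Proof.
  intros hd h. exists (mkposreal delta hd). intros r hr h0. apply h. split; [exact h0 |].
  change (Rabs (r - 0) < delta) in hr. apply Rabs_lt_between in hr. lra.
Qed.

Lemma filterlim_const_over_ln (c : R) :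
  filterlim (fun r => c / - ln r) (at_right 0) (locally 0).
Proof.
  intros P [eps heps]. pose proof (cond_pos eps) as he.
  apply (at_right_0_intro _ (exp (- ((Rabs c + 1) / eps)))); [apply exp_pos |].
  intros r hr. apply heps. change (Rabs (c / - ln r - 0) < eps). rewrite Rminus_0_r.
  assert (h : (Rabs c + 1) / eps < - ln r).
  { assert (ln r < - ((Rabs c + 1) / eps)); [| lra].
    rewrite <- (ln_exp (- _)). apply ln_increasing; lra. }
  pose proof (Rabs_pos c) as hc.
  assert (h0 : 0 < (Rabs c + 1) / eps) by (apply Rdiv_lt_0_compat; lra).
  unfold Rdiv. rewrite Rabs_mult, (Rabs_pos_eq (/ - ln r))
    by (left; apply Rinv_0_lt_compat; lra).
  apply Rmult_lt_reg_r with (- ln r); [lra |].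
  rewrite Rmult_assoc, Rinv_l, Rmult_1_r by lra.
  apply Rmult_lt_compat_l with (r := eps) in h; [| exact he].
  replace (eps * ((Rabs c + 1) / eps)) with (Rabs c + 1) in h by (field; lra). lra.
Qed.

(** Constants disappear on division by [- ln r]. The upper bound may lose any small power [r^(-e)],
    which leaves room for a logarithm in the count of the spiral. *)
Lemma is_box_dim_of_bounds (F : C -> Prop) (d c delta : R) :
  0 < c -> 0 < delta ->
  (forall r, 0 < r < delta -> c * Rpower r (- d) <= INR (covering_number r F)) ->
  (forall e, 0 < e -> exists K, 0 < K /\
     forall r, 0 < r < delta -> INR (covering_number r F) <= K * Rpower r (- (d + e))) ->
  is_box_dim F d.
Proof.
  intros hc hd hlow hup P [eps heps]. pose proof (cond_pos eps) as he.
  destruct (hup (eps / 2)) as [K [hK hup']]; [lra |].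
  assert (hev : forall a, at_right 0 (fun r => Rabs (a / - ln r) < eps / 2)).
  { intros a. apply (filterlim_const_over_ln a (fun y => Rabs y < eps / 2)).
    exists (mkposreal (eps / 2) ltac:(lra)). intros y hy.
    change (Rabs (y - 0) < eps / 2) in hy. now rewrite Rminus_0_r in hy. }
  assert (hr1 : at_right 0 (fun r => 0 < r < Rmin delta 1)).
  { apply (at_right_0_intro _ (Rmin delta 1)); [apply Rmin_pos; lra | auto]. }
  unfold filtermap.
  generalize (filter_and _ _ (filter_and _ _ (hev (ln c)) (hev (ln K))) hr1).
  apply filter_imp. intros r [[h1 h2] hr]. apply heps.
  change (Rabs (ln (INR (covering_number r F)) / - ln r - d) < eps).
  pose proof (Rmin_l delta 1). pose proof (Rmin_r delta 1).
  assert (hl : 0 < - ln r).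
  { assert (ln r < 0) by (rewrite <- ln_1; apply ln_increasing; lra). lra. }
  specialize (hlow r ltac:(lra)). specialize (hup' r ltac:(lra)).
  set (N := INR (covering_number r F)) in *.
  pose proof (Rpower_pos r (- d)) as p1. pose proof (Rpower_pos r (- (d + eps / 2))) as p2.
  assert (hN : 0 < c * Rpower r (- d)) by (apply Rmult_lt_0_compat; lra).
  assert (g1 : ln c + d * - ln r <= ln N).
  { replace (d * - ln r) with (ln (Rpower r (- d))) by (rewrite ln_Rpower; ring).
    rewrite <- ln_mult by lra. apply ln_le; lra. }
  assert (g2 : ln N <= ln K + (d + eps / 2) * - ln r).
  { replace ((d + eps / 2) * - ln r) with (ln (Rpower r (- (d + eps / 2))))
      by (rewrite ln_Rpower; ring).
    rewrite <- ln_mult by lra. apply ln_le; lra. }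
  apply Rabs_lt_between in h1, h2.
  assert (g3 : ln c / - ln r + d <= ln N / - ln r).
  { replace (ln c / - ln r + d) with ((ln c + d * - ln r) / - ln r) by (field; lra).
    apply Rmult_le_compat_r; [left; now apply Rinv_0_lt_compat | exact g1]. }
  assert (g4 : ln N / - ln r <= ln K / - ln r + (d + eps / 2)).
  { replace (ln K / - ln r + (d + eps / 2)) with ((ln K + (d + eps / 2) * - ln r) / - ln r)
      by (field; lra).
    apply Rmult_le_compat_r; [left; now apply Rinv_0_lt_compat | exact g2]. }
  apply Rabs_lt_between. lra.
Qed.

Lemma is_box_dim_unique (F : C -> Prop) (d d' : R) :
  is_box_dim F d -> is_box_dim F d' -> d = d'.
Proof. intros h h'. exact (filterlim_locally_unique _ d d' h h'). Qed.

Lemma box_distortion_holds : box_distortion.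
Proof.
  intros alpha X Y f ha hneX hX hneY hY hXY [K [hK hf]] dX dY hdX hdY.
  (* The scale in [X] at which [f] produces images of diameter at most [r]. *)
  set (eps := fun r => Rpower (/ K * r) (/ alpha)).
  assert (heps : filterlim eps (at_right 0) (at_right 0)).
  { intros P [d hd]. pose proof (cond_pos d) as hd0.
    apply (at_right_0_intro _ (K * Rpower d alpha)).
    - apply Rmult_lt_0_compat; [exact hK | apply Rpower_pos].
    - intros r hr. pose proof (Rpower_pos (/ K * r) (/ alpha)) as h0.
      pose proof (Rinv_0_lt_compat K hK) as hK'.
      apply hd; [| exact h0]. change (Rabs (eps r - 0) < d).
      rewrite Rminus_0_r, Rabs_pos_eq by (left; exact h0). unfold eps.
      rewrite <- (Rpower_inv_exponent d alpha) by lra.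
      apply Rlt_Rpower_l; [apply Rinv_0_lt_compat; lra |].
      split; [apply Rmult_lt_0_compat; lra |].
      apply Rmult_lt_reg_l with K; [exact hK |].
      rewrite <- Rmult_assoc, Rinv_r, Rmult_1_l; lra. }
  pose proof (filterlim_comp _ _ _ eps _ _ _ _ heps hdX) as h1.
  (* This function is the quotient of [- ln (eps r)] by [- ln r]; multiplying by it passes from the
     scale [eps r] to the scale [r]. *)
  assert (h2 : filterlim (fun r => / alpha + (ln K / alpha) / - ln r) (at_right 0)
    (locally (/ alpha + 0))).
  { apply (filterlim_comp_2 (F := at_right 0) (G := locally (/ alpha)) (H := locally 0)
      (fun _ => / alpha) (fun r => (ln K / alpha) / - ln r) Rplus).
    - apply filterlim_const.
    - apply filterlim_const_over_ln.
    - exact (filterlim_plus (V := R_NormedModule) (/ alpha) 0). }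
  rewrite Rplus_0_r in h2.
  assert (h3 : filterlim (fun r => ln (INR (covering_number (eps r) X)) / - ln (eps r) *
      (/ alpha + (ln K / alpha) / - ln r)) (at_right 0) (locally (dX * / alpha))).
  { apply (filterlim_comp_2 (F := at_right 0) (G := locally dX) (H := locally (/ alpha))
      _ _ Rmult h1 h2).
    exact (filterlim_mult (K := R_AbsRing) dX (/ alpha)). }
  apply (filterlim_le (F := at_right 0)
    (fun r => ln (INR (covering_number r Y)) / - ln r) _ (Finite dY) (Finite (dX * / alpha))
    ) in h3; [exact h3 | | exact hdY].
  (* [r < 1] and [r < K] keep both logarithms, of [r] and of [r/K], away from zero. *)
  apply (at_right_0_intro _ (Rmin 1 K)); [apply Rmin_pos; lra |].
  intros r hr. pose proof (Rmin_l 1 K). pose proof (Rmin_r 1 K).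
  pose proof (Rinv_0_lt_compat K hK) as hK'.
  assert (hl : ln r < 0) by (rewrite <- ln_1; apply ln_increasing; lra).
  assert (hKr : 0 < / K * r < 1).
  { split; [apply Rmult_lt_0_compat; lra |]. apply Rmult_lt_reg_l with K; [exact hK |].
    rewrite <- Rmult_assoc, Rinv_r, Rmult_1_l; lra. }
  assert (hle : ln (eps r) = (ln r - ln K) / alpha).
  { unfold eps. rewrite ln_Rpower, ln_mult, ln_Rinv by lra. field. lra. }
  assert (hlK : ln r - ln K < 0).
  { assert (h : ln (/ K * r) < 0) by (rewrite <- ln_1; apply ln_increasing; lra).
    rewrite ln_mult, ln_Rinv in h by lra. lra. }
  rewrite hle.
  replace (ln (INR (covering_number (eps r) X)) / - ((ln r - ln K) / alpha) *
    (/ alpha + ln K / alpha / - ln r)) with (ln (INR (covering_number (eps r) X)) / - ln r)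
    by (field; lra).
  apply Rmult_le_compat_r; [left; apply Rinv_0_lt_compat; lra |].
  pose proof (covering_number_ge_1 r Y ltac:(lra) hY hneY) as hN.
  apply ln_le; [lra |]. apply covering_number_le.
  pose proof (bounded_covering_number (eps r) X (Rpower_pos _ _) hX) as hc.
  eexists. split; [| apply Rle_refl].
  eapply has_cover_weaken; [apply Rle_refl | |
    apply (has_cover_image alpha K (eps r) r X X f _ ltac:(lra) hK); [| exact hf | auto | exact hc]].
  - intros y hy. exact (proj1 (hXY y) hy).
  - unfold eps. rewrite Rpower_mult, Rinv_l, Rpower_1 by lra. right. field. lra.
Qed.

(** * Lower bounds for the dimensions *)

Lemma covering_number_monotone (r : R) (F G : C -> Prop) :
  0 < r -> bounded F -> (forall z, G z -> F z) ->
  INR (covering_number r G) <= INR (covering_number r F).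
Proof.
  intros hr hF hGF. apply covering_number_le. eexists. split; [| apply Rle_refl].
  eapply has_cover_weaken; [apply Rle_refl | exact hGF |].
  now apply bounded_covering_number.
Qed.

Lemma bounded_unit_interval : bounded unit_interval.
Proof.
  exists 1. intros z [t [ht ->]]. rewrite Cmod_R, Rabs_pos_eq; lra.
Qed.

Lemma nonempty_unit_interval : nonempty unit_interval.
Proof. exists (RtoC (/ 2)), (/ 2). split; [lra | reflexivity]. Qed.

Lemma covered_unit_interval_ball (r rho : R) (x : C) :
  0 < r -> 0 < rho -> covered r (ball_in unit_interval x rho) (2 * rho / r + 2).
Proof.
  intros hr hrho. replace (2 * rho) with (1 * (2 * rho)) by ring.
  apply (covered_curve r 1 (fst x - rho) (2 * rho) RtoC); try lra.
  - intros s t _ _. rewrite Cdist_R. lra.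
  - intros z [[t [ht ->]] hz]. exists t. split; [| reflexivity].
    pose proof (Rabs_fst_le_Cdist (RtoC t) x) as h. change (fst (RtoC t)) with t in h.
    assert (h' : Rabs (t - fst x) <= rho) by lra. apply Rabs_le_between in h'. lra.
Qed.

Lemma covered_unit_interval (r : R) : 0 < r -> covered r unit_interval (1 / r + 2).
Proof.
  intros hr. replace (1 / r) with (1 * 1 / r) by (field; lra).
  apply (covered_curve r 1 0 1 RtoC); try lra.
  - intros s t _ _. rewrite Cdist_R. lra.
  - intros z [t [ht ->]]. exists t. split; [lra | reflexivity].
Qed.

(** The points [1/2 + 2 r k] have spacing [2 r > r], and those within [rho/2 <= 1/4] of [1/2] stay
    in the interval. *)
Lemma unit_interval_ball_lower (r rho : R) :
  0 < r -> 0 < rho <= / 2 ->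
  rho / (4 * r) <= INR (covering_number r (ball_in unit_interval (RtoC (/ 2)) rho)).
Proof.
  intros hr hrho.
  destruct (nat_ceil (rho / (4 * r))) as [m [hm1 hm2]].
  { left. apply Rdiv_lt_0_compat; lra. }
  eapply Rle_trans; [exact hm1 |]. apply le_INR.
  assert (hk : forall k, (k < m)%nat -> 0 <= 2 * r * INR k < rho / 2).
  { intros k hk. pose proof (pos_INR k). split; [nra |].
    assert (h : INR k + 1 <= INR m) by (rewrite <- S_INR; apply le_INR; lia).
    assert (h' : INR k < rho / (4 * r)) by lra.
    apply Rmult_lt_compat_l with (r := 2 * r) in h'; [| lra].
    replace (2 * r * (rho / (4 * r))) with (rho / 2) in h' by (field; lra). exact h'. }
  apply (packing r (ball_in unit_interval (RtoC (/ 2)) rho)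
    (fun k => RtoC (/ 2 + 2 * r * INR k)) m).
  - intros k h. specialize (hk k h). split.
    + eexists. split; [| reflexivity]. lra.
    + rewrite Cdist_R, Rabs_pos_eq; lra.
  - intros i j hij hj. rewrite Cdist_R, Rabs_left1.
    + assert (h : INR i + 1 <= INR j) by (rewrite <- S_INR; apply le_INR; lia). nra.
    + assert (h : INR i + 1 <= INR j) by (rewrite <- S_INR; apply le_INR; lia). nra.
  - apply bounded_covering_number; [exact hr |].
    apply bounded_ball_in, bounded_unit_interval.
Qed.

Lemma assouad_spectrum_unit_interval (theta : R) :
  0 < theta < 1 -> assouad_spectrum theta unit_interval = 1.
Proof.
  intros ht. apply Rle_antisym.
  - apply spectrum_le_exponent; [exact ht | apply nonempty_unit_interval |
      apply bounded_unit_interval |].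
    exists 4. split; [lra |]. intros r x hr hx.
    pose proof (scale_ratio_ge_1 r theta hr ltac:(lra)) as hq.
    rewrite Rpower_1 by lra. apply covering_number_le.
    eapply covered_weaken; [apply Rle_refl | intros z hz; exact hz | |
      apply covered_unit_interval_ball; [lra | apply Rpower_pos]].
    unfold Rdiv in *. lra.
  - apply spectrum_ge; [exact ht | apply nonempty_unit_interval | apply bounded_unit_interval |].
    (* Below this threshold [r^theta <= 1/2], as the net about [1/2] requires. *)
    intros s. apply (spectrum_exponent_lower theta 1 (/ 4) (Rpower (/ 2) (/ theta)));
      [exact ht | lra | apply Rpower_pos |].
    intros r hr. exists (RtoC (/ 2)). split; [exists (/ 2); split; [lra | reflexivity] |].
    assert (h : Rpower r theta <= / 2).
    { replace (/ 2) with (Rpower (Rpower (/ 2) (/ theta)) theta).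
      - apply Rle_Rpower_l; lra.
      - rewrite Rpower_mult, Rinv_l, Rpower_1; lra. }
    pose proof (Rpower_pos r theta) as h0.
    rewrite Rpower_1 by (apply Rdiv_lt_0_compat; lra).
    replace (/ 4 * (Rpower r theta / r)) with (Rpower r theta / (4 * r)) by (field; lra).
    apply unit_interval_ball_lower; lra.
Qed.

Lemma box_dim_unit_interval : is_box_dim unit_interval 1.
Proof.
  apply (is_box_dim_of_bounds _ 1 (/ 8) 1); [lra | lra | |].
  - intros r hr. rewrite Rpower_Ropp, Rpower_1 by lra.
    apply Rle_trans with (/ 2 / (4 * r)); [right; field; lra |].
    eapply Rle_trans; [apply unit_interval_ball_lower; lra |].
    apply covering_number_monotone; [lra | apply bounded_unit_interval | now intros z [hz _]].
  - intros e he. exists 3. split; [lra |]. intros r hr. apply covering_number_le.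
    eapply covered_weaken; [apply Rle_refl | intros z hz; exact hz | |
      apply covered_unit_interval; lra].
    assert (h1 : 1 <= / r) by (rewrite <- Rinv_1; apply Rinv_le_contravar; lra).
    assert (h2 : / r <= Rpower r (- (1 + e))).
    { rewrite <- (Rpower_1 r) at 1 by lra. rewrite <- Rpower_Ropp.
      apply Rpower_antitone_exponent; lra. }
    unfold Rdiv. lra.
Qed.

Lemma bounded_spiral (p : R) : 0 < p -> bounded (spiral p).
Proof.
  intros hp. exists 1. intros z [x [hx ->]]. change (Cmod (spiral_at p x) <= 1).
  rewrite Cmod_spiral_at, <- (Rpower_base_1 (- p)). apply Rpower_antitone_base; lra.
Qed.

Lemma nonempty_spiral (p : R) : nonempty (spiral p).
Proof. exists (spiral_at p 2). apply spiral_spiral_at. lra. Qed.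

(* Near the origin the turns of the spiral through radius [r^(p/(p+1))] are about [r] apart, so
   a suitable net of points [x = A X + m j + d k] is [r]-separated. *)
Lemma spiral_core_lower (p : R) :
  0 < p -> exists c, 0 < c /\ forall (r : R) (n : nat), 0 < r < 1 ->
    has_cover r (fun z => spiral p z /\ Cmod z <= Rpower r (p / (p + 1)) / 2) n ->
    c * Rpower r (- (2 / (p + 1))) <= INR n.
Proof.
  intros hp.
  (* Chosen so that [(A X)^(-p)] is half of [X^(-p)], the required bound on the modulus. *)
  set (A := Rpower 2 (/ p)).
  assert (hp' : 0 < / p) by now apply Rinv_0_lt_compat.
  assert (hA : 1 <= A) by (apply Rpower_ge_1; lra).
  set (W := Rpower (A + 2) (- p - 1)). assert (hW : 0 < W) by apply Rpower_pos.
  (* Points in different rows differ in angle by at least [m - 1], since each row spans at most one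
     radian. Their radii then differ by at least [p W r (m - 1) = r + p W r > r]. *)
  set (m := / (p * W) + 2).
  assert (hpW : 0 < p * W) by (apply Rmult_lt_0_compat; lra).
  assert (hm : 2 < m) by (unfold m; pose proof (Rinv_0_lt_compat _ hpW); lra).
  set (V := Rpower 2 (- p) * Rpower (A + 2) (- p)).
  assert (hV : 0 < V) by (apply Rmult_lt_0_compat; apply Rpower_pos).
  (* Within a row the angular step is [d = B / X]; by [spiral_at_lower] neighbours are at least
     [V (r X) d / 2 = 2 r] apart. *)
  set (B := 4 / V). assert (hB : 0 < B) by (apply Rdiv_lt_0_compat; lra).
  assert (hmB : 0 < m * B) by (apply Rmult_lt_0_compat; lra).
  exists (/ (m * B)). split; [now apply Rinv_0_lt_compat |].
  intros r n hr hn.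
  (* The angle at which the radial gap between turns, of order [X^(-p-1)], equals [r]. There are
     about [X / m] rows of [X / B] points each, and [X^2 = r^(-2/(p+1))]. *)
  set (X := Rpower r (- / (p + 1))).
  assert (hq : 0 < / (p + 1)) by (apply Rinv_0_lt_compat; lra).
  assert (hX : 1 <= X).
  { unfold X. rewrite <- (Rpower_O r) at 1 by lra. apply Rpower_antitone_exponent; lra. }
  assert (hXp1 : Rpower X (- p - 1) = r).
  { unfold X. rewrite Rpower_mult. replace (- / (p + 1) * (- p - 1)) with 1 by (field; lra).
    apply Rpower_1. lra. }
  assert (hXp : Rpower X (- p) = Rpower r (p / (p + 1))).
  { unfold X. rewrite Rpower_mult. f_equal. field. lra. }
  assert (hXr : Rpower X (- p) = r * X).
  { rewrite Rpower_minus_1 in hXp1 by lra. rewrite <- hXp1. field. lra. }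
  set (d := B / X). assert (hd : 0 < d) by (apply Rdiv_lt_0_compat; lra).
  destruct (nat_ceil (X / m)) as [J [hJ1 hJ2]]; [apply Rdiv_le_0_compat; lra |].
  destruct (nat_ceil (/ d)) as [K [hK1 hK2]]; [left; now apply Rinv_0_lt_compat |].
  set (x := fun j k => A * X + m * INR j + d * INR k).
  assert (hj : forall j, (j < J)%nat -> 0 <= m * INR j <= X).
  { intros j h. pose proof (pos_INR j). split; [nra |].
    assert (h1 : INR j + 1 <= INR J) by (rewrite <- S_INR; apply le_INR; lia).
    assert (h2 : INR j <= X / m) by lra.
    apply Rmult_le_compat_l with (r := m) in h2; [| lra].
    replace (m * (X / m)) with X in h2 by (field; lra). exact h2. }
  assert (hk : forall k, (k < K)%nat -> 0 <= d * INR k <= 1).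
  { intros k h. pose proof (pos_INR k). split; [nra |].
    assert (h1 : INR k + 1 <= INR K) by (rewrite <- S_INR; apply le_INR; lia).
    assert (h2 : INR k <= / d) by lra.
    apply Rmult_le_compat_l with (r := d) in h2; [| lra].
    rewrite Rinv_r in h2 by lra. exact h2. }
  assert (hx : forall j k, (j < J)%nat -> (k < K)%nat -> A * X <= x j k <= (A + 2) * X).
  { intros j k h h'. specialize (hj j h). specialize (hk k h'). unfold x. lra. }
  assert (hAX : 1 <= A * X) by nra.
  assert (hJK : (J * K <= n)%nat).
  { apply (packing_grid r _ (fun j k => spiral_at p (x j k)) J K n) in hn; [exact hn | | |].
    - intros j k h h'. specialize (hx j k h h'). split.
      + apply spiral_spiral_at.
        assert (1 < A).
        { unfold A. rewrite <- (Rpower_O 2) by lra. apply Rpower_lt; lra. }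
        nra.
      + rewrite Cmod_spiral_at. apply Rle_trans with (Rpower (A * X) (- p)).
        * apply Rpower_antitone_base; lra.
        * rewrite <- Rpower_mult_distr, hXp by lra. unfold A. rewrite Rpower_mult.
          replace (/ p * - p) with (- (1)) by (field; lra).
          rewrite Rpower_Ropp, Rpower_1 by lra. lra.
    - intros j j' k k' hjj hj' h h'.
      pose proof (hx j k ltac:(lia) h) as hx1. pose proof (hx j' k' hj' h') as hx2.
      pose proof (hk k h) as hk1. pose proof (hk k' h') as hk2.
      assert (hxx : m - 1 <= x j' k' - x j k).
      { assert (h1 : INR j + 1 <= INR j') by (rewrite <- S_INR; apply le_INR; lia).
        unfold x. nra. }
      eapply Rlt_le_trans; [| apply Rabs_Cmod_minus].
      rewrite !Cmod_spiral_at.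
      pose proof (Rpower_neg_diff (x j k) (x j' k') p ltac:(lra) ltac:(lra) hp) as [h1 _].
      assert (h2 : W * r <= Rpower (x j' k') (- p - 1)).
      { unfold W. rewrite <- hXp1, Rpower_mult_distr by lra. apply Rpower_antitone_base; lra. }
      assert (h3 : p * (W * r) * (m - 1) <= p * Rpower (x j' k') (- p - 1) * (x j' k' - x j k)).
      { apply Rmult_le_compat; try lra.
        - apply Rmult_le_pos; [lra |]. apply Rmult_le_pos; lra.
        - apply Rmult_le_compat_l; lra. }
      replace (p * (W * r) * (m - 1)) with (r + p * W * r) in h3
        by (unfold m; field; lra).
      pose proof (Rle_abs (Rpower (x j k) (- p) - Rpower (x j' k') (- p))).
      assert (0 < p * W * r) by (apply Rmult_lt_0_compat; lra). lra.
    - intros j k k' h hkk h'.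
      pose proof (hx j k h ltac:(lia)) as hx1.
      pose proof (hk k ltac:(lia)) as hk1. pose proof (hk k' h') as hk2.
      assert (hxx : d <= x j k' - x j k <= 1).
      { assert (h1 : INR k + 1 <= INR k') by (rewrite <- S_INR; apply le_INR; lia).
        unfold x. split; nra. }
      eapply Rlt_le_trans; [| apply spiral_at_lower; lra].
      assert (h1 : Rpower (A + 2) (- p) * (r * X) <= Rpower (x j k) (- p)).
      { rewrite <- hXr, Rpower_mult_distr by lra. apply Rpower_antitone_base; lra. }
      pose proof (Rpower_pos 2 (- p)) as h2.
      assert (h3 : V * (r * X) <= Rpower 2 (- p) * Rpower (x j k) (- p)).
      { unfold V. rewrite Rmult_assoc. apply Rmult_le_compat_l; lra. }
      assert (h4 : V * (r * X) * d <= Rpower 2 (- p) * Rpower (x j k) (- p) * (x j k' - x j k)).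
      { apply Rmult_le_compat; try lra. apply Rmult_le_pos; [lra |]. nra. }
      replace (V * (r * X) * d) with (4 * r) in h4 by (unfold d, B; field; lra). lra. }
  apply le_INR in hJK. rewrite mult_INR in hJK.
  eapply Rle_trans; [| exact hJK].
  apply Rle_trans with (X / m * / d).
  - right. replace (Rpower r (- (2 / (p + 1)))) with (X * X).
    + unfold d. field. repeat split; lra.
    + unfold X. rewrite <- Rpower_plus. f_equal. field. lra.
  - apply Rmult_le_compat; try lra.
    + apply Rdiv_le_0_compat; lra.
    + left. now apply Rinv_0_lt_compat.
Qed.

(** The spiral meets every radius in [(0, 1)], so points of moduli [1/4 + 2 r k] form a separated
    net. This gives the lower bound 1 for the box dimension when [p > 1]. *)
Lemma spiral_radial_lower (p r : R) :
  0 < p -> 0 < r -> / (4 * r) <= INR (covering_number r (spiral p)).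
Proof.
  intros hp hr.
  destruct (nat_ceil (/ (4 * r))) as [m [hm1 hm2]].
  { left. apply Rinv_0_lt_compat; lra. }
  eapply Rle_trans; [exact hm1 |]. apply le_INR.
  set (t := fun k : nat => / 4 + 2 * r * INR k).
  assert (ht : forall k, (k < m)%nat -> 0 < t k < 1).
  { intros k hk. pose proof (pos_INR k). unfold t. split; [nra |].
    assert (h : INR k + 1 <= INR m) by (rewrite <- S_INR; apply le_INR; lia).
    assert (h' : INR k < / (4 * r)) by lra.
    apply Rmult_lt_compat_l with (r := 2 * r) in h'; [| lra].
    replace (2 * r * / (4 * r)) with (/ 2) in h' by (field; lra). lra. }
  assert (hmod : forall k, (k < m)%nat -> Cmod (spiral_at p (Rpower (t k) (- / p))) = t k).
  { intros k hk. rewrite Cmod_spiral_at, Rpower_mult.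
    replace (- / p * - p) with 1 by (field; lra). apply Rpower_1. apply ht, hk. }
  apply (packing r (spiral p) (fun k => spiral_at p (Rpower (t k) (- / p))) m).
  - intros k hk. apply spiral_spiral_at. specialize (ht k hk).
    pose proof (Rinv_0_lt_compat p hp).
    unfold Rpower. rewrite <- exp_0 at 1. apply exp_increasing.
    assert (ln (t k) < 0) by (rewrite <- ln_1; apply ln_increasing; lra). nra.
  - intros i j hij hj. eapply Rlt_le_trans; [| apply Rabs_Cmod_minus].
    rewrite !hmod by lia. unfold t.
    assert (h : INR i + 1 <= INR j) by (rewrite <- S_INR; apply le_INR; lia).
    rewrite Rabs_left1; nra.
  - apply bounded_covering_number; [exact hr | now apply bounded_spiral].
Qed.

Lemma assouad_spectrum_spiral_ge (p : R) :
  0 < p -> 2 <= assouad_spectrum (p / (p + 1)) (spiral p).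
Proof.
  intros hp.
  assert (ht : 0 < p / (p + 1) < 1).
  { split; [apply Rdiv_lt_0_compat; lra |]. apply Rmult_lt_reg_r with (p + 1); [lra |].
    field_simplify; lra. }
  apply spectrum_ge; [exact ht | apply nonempty_spiral | now apply bounded_spiral |].
  destruct (spiral_core_lower p hp) as [c [hc hcore]].
  intros s. apply (spectrum_exponent_lower _ 2 c 1); [exact ht | exact hc | lra |].
  intros r hr. set (rho := Rpower r (p / (p + 1))) in *.
  assert (hrho : 0 < rho <= 1) by (split; [apply Rpower_pos | apply Rpower_le_1; lra]).
  (* The origin is not on the spiral; a centre of modulus [rho/4] still has the core of modulus at
     most [rho/2] within [rho]. *)
  set (x := Rpower (rho / 4) (- / p)).
  pose proof (Rinv_0_lt_compat p hp) as hp'.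
  assert (hx : 1 < x).
  { unfold x, Rpower. rewrite <- exp_0 at 1. apply exp_increasing.
    assert (ln (rho / 4) < 0) by (rewrite <- ln_1; apply ln_increasing; lra). nra. }
  assert (hmod : Cmod (spiral_at p x) = rho / 4).
  { rewrite Cmod_spiral_at. unfold x. rewrite Rpower_mult.
    replace (- / p * - p) with 1 by (field; lra). apply Rpower_1. lra. }
  exists (spiral_at p x). split; [now apply spiral_spiral_at |].
  unfold rho at 1. rewrite Rpower_scale_ratio by lra.
  replace ((p / (p + 1) - 1) * 2) with (- (2 / (p + 1))) by (field; lra).
  apply hcore; [exact hr |].
  eapply has_cover_weaken; [apply Rle_refl | |
    apply bounded_covering_number; [lra | apply bounded_ball_in, bounded_spiral, hp]].
  intros z [hz1 hz2]. split; [exact hz1 |].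
  eapply Rle_trans; [apply Cdist_le_Cmod |]. rewrite hmod. fold rho in hz2. lra.
Qed.

(** * Upper bounds for the dimensions *)

Lemma ln_le_minus_1 (x : R) : 0 < x -> ln x <= x - 1.
Proof.
  intros hx. pose proof (exp_ineq1_le (ln x)) as h. rewrite exp_ln in h by exact hx. lra.
Qed.

(** Induction on [1/(N+1) <= ln (N+1) - ln N]. The summand [b] carries the constant part of the
    count of each arc. *)
Lemma harmonic_sum_le (n : nat) (U b : R) (f : nat -> R) :
  (0 < n)%nat -> 0 <= U ->
  (forall i, (i < n)%nat -> f i <= U / (INR i + 1) + b) ->
  fold_right Rplus 0 (map f (seq 0 n)) <= U * (1 + ln (INR n)) + INR n * b.
Proof.
  intros hn hU hf. induction n as [| n IH]; [lia |]. clear hn.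
  assert (e : forall l t, fold_right Rplus t l = fold_right Rplus 0 l + t).
  { intros l t. induction l as [| y l IHl]; simpl; [lra | rewrite IHl; lra]. }
  rewrite seq_S, map_app, fold_right_app. simpl fold_right. rewrite e, Rplus_0_r.
  specialize (hf n ltac:(lia)) as hfn.
  destruct n as [| n].
  - simpl in *. rewrite ln_1. lra.
  - specialize (IH ltac:(lia) (fun i hi => hf i ltac:(lia))).
    rewrite (S_INR (S n)). set (N := INR (S n)) in *.
    assert (hN : 1 <= N) by (apply (le_INR 1); lia).
    assert (h : / (N + 1) <= ln (N + 1) - ln N).
    { pose proof (ln_le_minus_1 (N / (N + 1))) as h.
      unfold Rdiv in h. rewrite ln_mult, ln_Rinv in h by (try apply Rinv_0_lt_compat; lra).
      replace (N * / (N + 1) - 1) with (- / (N + 1)) in h by (field; lra).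
      assert (0 < N * / (N + 1)) by (apply Rdiv_lt_0_compat; lra). lra. }
    apply Rmult_le_compat_l with (r := U) in h; [| exact hU].
    unfold Rdiv in hfn. simpl Nat.add. lra.
Qed.

(** The whole arc has length of order [j^(-p)]. On one radian distances are comparable to [j^(-p)]
    times angles, so the part inside the disc lies in a parameter interval about any of its points,
    of length of order [rho / j^(-p)], and its arc length is of order [rho]. *)
Lemma covered_spiral_arc (p r rho : R) (z0 : C) (j : R) :
  0 < p -> 0 < r -> 0 < rho -> 1 <= j ->
  covered r (fun z => Cdist z z0 <= rho /\ exists x, j <= x <= j + 1 /\ z = spiral_at p x)
    (8 * (p + 1) * Rpower 4 p * Rmin rho (Rpower j (- p)) / r + 2).
Proof.
  intros hp hr hrho hj.
  set (C4 := Rpower 4 p). assert (hC4 : 1 <= C4) by (apply Rpower_ge_1; lra).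
  set (J := Rpower j (- p)). assert (hJ : 0 < J) by apply Rpower_pos.
  assert (hmin : 0 < Rmin rho J) by (now apply Rmin_pos).
  destruct (classic (exists x, j <= x <= j + 1 /\ Cdist (spiral_at p x) z0 <= rho))
    as [[x0 [hx0 hx0']] | hne].
  2:{ eapply covered_weaken; [apply Rle_refl | | | apply (covered_small r (fun _ => False))].
      - intros z [hz [x [hx ->]]]. apply hne. now exists x.
      - assert (0 <= 8 * (p + 1) * C4 * Rmin rho J / r); [| lra].
        apply Rdiv_le_0_compat; [| exact hr]. repeat apply Rmult_le_pos; lra.
      - intros z w []. }
  (* Two points in the disc are at most [2 rho] apart, and [x <= 2 j] on the arc, so
     [spiral_at_lower] bounds their difference of angle by [l]; this is also where [4^p] comes
     from. *)
  set (l := 4 * rho * C4 / J).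
  assert (hl : 0 < l).
  { apply Rdiv_lt_0_compat; [| exact hJ]. repeat apply Rmult_lt_0_compat; lra. }
  assert (hdist : forall x y, j <= x -> x <= y -> y <= j + 1 ->
    Cdist (spiral_at p x) z0 <= rho -> Cdist (spiral_at p y) z0 <= rho -> y - x <= l).
  { intros x y hx hxy hy hx' hy'.
    pose proof (spiral_at_lower p x y hp ltac:(lra) ltac:(lra)) as h1.
    pose proof (Cdist_triangle (spiral_at p x) z0 (spiral_at p y)) as h2.
    rewrite (Cdist_sym z0) in h2.
    assert (h3 : / C4 * J <= Rpower 2 (- p) * Rpower x (- p)).
    { unfold C4, J. rewrite <- Rpower_Ropp, !Rpower_mult_distr by lra.
      replace (4 * j) with (2 * (2 * j)) by ring.
      apply Rpower_antitone_base; lra. }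
    assert (h4 : / C4 * J * (y - x) <= 4 * rho).
    { apply Rle_trans with (Rpower 2 (- p) * Rpower x (- p) * (y - x)); [| lra].
      apply Rmult_le_compat_r; lra. }
    unfold l. apply Rmult_le_reg_l with (/ C4 * J).
    - apply Rmult_lt_0_compat; [apply Rinv_0_lt_compat; lra | exact hJ].
    - replace (/ C4 * J * (4 * rho * C4 / J)) with (4 * rho) by (field; lra). exact h4. }
  set (a := Rmax j (x0 - l)). set (b := Rmin (j + 1) (x0 + l)).
  assert (hab : j <= a /\ x0 - l <= a /\ a <= x0 /\ x0 <= b /\ b <= j + 1 /\ b <= x0 + l).
  { unfold a, b, Rmax, Rmin.
    destruct (Rle_dec j (x0 - l)); destruct (Rle_dec (j + 1) (x0 + l)); lra. }
  apply (covered_weaken r _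
    (fun z => Cdist z z0 <= rho /\ exists x, j <= x <= j + 1 /\ z = spiral_at p x) _
    ((p + 1) * J * (b - a) / r + 2)); [lra | auto | |].
  - apply Rplus_le_compat_r. apply Rmult_le_compat_r; [left; now apply Rinv_0_lt_compat |].
    destruct (Rle_lt_dec rho J); [rewrite Rmin_left by lra | rewrite Rmin_right by lra].
    + replace (8 * (p + 1) * C4 * rho) with ((p + 1) * J * (2 * l)) by (unfold l; field; lra).
      apply Rmult_le_compat_l; [apply Rmult_le_pos |]; lra.
    + apply Rle_trans with ((p + 1) * J * 1).
      * apply Rmult_le_compat_l; [apply Rmult_le_pos |]; lra.
      * assert (0 < (p + 1) * J) by (apply Rmult_lt_0_compat; lra). nra.
  - apply (covered_curve r ((p + 1) * J) a (b - a) (spiral_at p)); [exact hr | | lra | |].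
    + apply Rmult_lt_0_compat; lra.
    + assert (hlip : forall x y, j <= x -> x <= y ->
        Cdist (spiral_at p x) (spiral_at p y) <= (p + 1) * J * (y - x)).
      { intros x y hx hxy. eapply Rle_trans; [apply spiral_at_upper; lra |].
        apply Rmult_le_compat_r; [lra |].
        assert (h1 : Rpower x (- p) <= J) by (apply Rpower_antitone_base; lra).
        assert (h2 : Rpower x (- p - 1) <= J).
        { apply Rle_trans with (Rpower x (- p)); [| exact h1]. apply Rle_Rpower; lra. }
        nra. }
      intros x y hx hy. destruct (Rle_lt_dec x y).
      * rewrite Rabs_left1 by lra. replace (- (x - y)) with (y - x) by ring. apply hlip; lra.
      * rewrite Rabs_right, Cdist_sym by lra. apply hlip; lra.
    + intros z [hz [x [hx ->]]]. exists x. split; [| reflexivity].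
      replace (a + (b - a)) with b by ring.
      destruct (Rle_lt_dec x x0) as [h | h].
      * pose proof (hdist x x0 ltac:(lra) h ltac:(lra) hz hx0').
        split; [| lra]. unfold a. apply Rmax_lub; lra.
      * pose proof (hdist x0 x ltac:(lra) ltac:(lra) ltac:(lra) hx0' hz).
        split; [lra |]. unfold b. apply Rmin_glb; lra.
Qed.

(* The turns are cut off at [x = r^(-1/(p+1))]: beyond it a disc is covered, before it the arcs
   [j <= x <= j+1] one by one. The weight [V / j] makes the sum over the arcs logarithmic, and
   the logarithm is absorbed by [r^(-e)]. *)
Lemma covered_spiral_ball (p e : R) :
  0 < p -> 0 < e -> exists K, 0 < K /\
  forall (r rho V : R) (z0 : C), 0 < r < 1 -> 0 < rho -> 0 <= V ->
    (forall j, 1 <= j <= 2 * Rpower r (- / (p + 1)) -> Rmin rho (Rpower j (- p)) <= V / j) ->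
    covered r (ball_in (spiral p) z0 rho)
      (K * (Rpower r (- (2 / (p + 1))) + V / r) * Rpower r (- e)).
Proof.
  intros hp he.
  set (D := 8 * (p + 1) * Rpower 4 p).
  assert (hD : 0 < D).
  { unfold D. apply Rmult_lt_0_compat; [lra | apply Rpower_pos]. }
  set (E := 2 + / e). assert (hE : 2 < E) by (unfold E; pose proof (Rinv_0_lt_compat e he); lra).
  (* The disc contributes 25, and the 2 per arc contributes [2 n <= 4 X <= 4 X^2]. [E] comes from
     [1 + ln n <= 2 - ln r] and [- ln r <= r^(-e) / e]. *)
  exists (29 + D * E). split; [nra |].
  intros r rho V z0 hr hrho hV hmin.
  assert (hq : 0 < / (p + 1) < 1).
  { split; [apply Rinv_0_lt_compat; lra |]. rewrite <- Rinv_1 at 2.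
    apply Rinv_lt_contravar; lra. }
  set (X := Rpower r (- / (p + 1))).
  assert (hX : 1 <= X).
  { unfold X. rewrite <- (Rpower_O r) at 1 by lra. apply Rpower_antitone_exponent; lra. }
  assert (hXp : Rpower X (- p) = Rpower r (p / (p + 1))).
  { unfold X. rewrite Rpower_mult. f_equal. field. lra. }
  set (core := Rpower r (p / (p + 1))) in *.
  assert (hcore : r <= core).
  { apply scale_le; [exact hr |]. apply Rmult_le_reg_r with (p + 1); [lra |]. field_simplify; lra. }
  set (G := Rpower r (- (2 / (p + 1)))).
  assert (hG : (core / r) ^ 2 = G).
  { unfold core, G. assert (0 < Rpower r (p / (p + 1)) / r)
      by (apply Rdiv_lt_0_compat; [apply Rpower_pos | lra]).
    rewrite <- Rpower_pow by assumption. rewrite Rpower_scale_ratio by lra.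
    f_equal. simpl. field. lra. }
  assert (hXX : X * X = G).
  { unfold X, G. rewrite <- Rpower_plus. f_equal. field. lra. }
  destruct (nat_ceil X ltac:(lra)) as [n [hn1 hn2]].
  assert (hn : (0 < n)%nat) by (apply INR_lt; simpl; lra).
  set (P := Rpower r (- e)).
  assert (hP : 1 <= P).
  { unfold P. rewrite <- (Rpower_O r) at 1 by lra. apply Rpower_antitone_exponent; lra. }
  assert (hln : 1 + ln (INR n) <= E * P).
  { assert (h1 : ln (INR n) <= 1 + - ln r).
    { apply Rle_trans with (ln (2 * X)); [apply ln_le; lra |].
      rewrite ln_mult by lra. unfold X. rewrite ln_Rpower.
      pose proof (ln_le_minus_1 2).
      assert (ln r < 0) by (rewrite <- ln_1; apply ln_increasing; lra). nra. }
    assert (h2 : e * - ln r <= P).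
    { unfold P, Rpower. pose proof (exp_ineq1_le (- e * ln r)). lra. }
    assert (h3 : - ln r <= / e * P).
    { apply Rmult_le_reg_l with e; [exact he |].
      replace (e * (/ e * P)) with P by (field; lra). exact h2. }
    unfold E. lra. }
  assert (hA : covered r (fun z => Cdist z (RtoC 0) <= core) (25 * G)).
  { rewrite <- hG. apply covered_disc with (RtoC 0); [lra | auto]. }
  pose proof (covered_bigunion r
    (fun i z => Cdist z z0 <= rho /\
       exists x, INR i + 1 <= x <= INR i + 1 + 1 /\ z = spiral_at p x)
    _ n (fun i _ => covered_spiral_arc p r rho z0 (INR i + 1) hp (proj1 hr) hrho
                      ltac:(pose proof (pos_INR i); lra))) as hB.
  fold D in hB.
  eapply covered_weaken; [apply Rle_refl | | | exact (covered_union _ _ _ _ _ hA hB)].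
  - intros z [[x [hx ->]] hz]. change (Cdist (spiral_at p x) z0 <= rho) in hz.
    change (Cmult _ _) with (spiral_at p x).
    destruct (Rle_lt_dec (INR n) x) as [h | h].
    + left. eapply Rle_trans; [apply Cdist_le_Cmod |].
      rewrite Cmod_0, Rplus_0_r, Cmod_spiral_at, <- hXp. apply Rpower_antitone_base; lra.
    + right. destruct (grid_index 1 (x - 1) n hn) as [i [hi hi']]; [lra |].
      exists i. split; [exact hi |]. split; [exact hz |]. exists x. split; [lra | reflexivity].
  - pose proof (harmonic_sum_le n (D * V / r) 2
      (fun i => D * Rmin rho (Rpower (INR i + 1) (- p)) / r + 2) hn) as hs.
    eapply Rle_trans; [apply Rplus_le_compat_l, hs |].
    + apply Rdiv_le_0_compat; [apply Rmult_le_pos |]; lra.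
    + intros i hi. apply Rplus_le_compat_r.
      assert (h1 : INR i + 1 <= INR n) by (rewrite <- S_INR; apply le_INR; lia).
      pose proof (pos_INR i) as h0.
      pose proof (hmin (INR i + 1)) as h2. fold X in h2. specialize (h2 ltac:(lra)).
      replace (D * V / r / (INR i + 1)) with (D / r * (V / (INR i + 1))) by (field; lra).
      replace (D * Rmin rho (Rpower (INR i + 1) (- p)) / r)
        with (D / r * Rmin rho (Rpower (INR i + 1) (- p))) by (field; lra).
      apply Rmult_le_compat_l; [| exact h2]. apply Rdiv_le_0_compat; lra.
    + assert (hVr : 0 <= V / r) by (apply Rdiv_le_0_compat; lra).
      assert (hG1 : X <= G) by nra.
      assert (h1 : D * V / r * (1 + ln (INR n)) <= D * E * (V / r) * P).
      { replace (D * E * (V / r) * P) with (D * V / r * (E * P)) by (field; lra).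
        apply Rmult_le_compat_l; [| exact hln].
        apply Rdiv_le_0_compat; [apply Rmult_le_pos |]; lra. }
      assert (h2 : G <= G * P) by nra.
      assert (h3 : 0 <= D * E * (G * P)).
      { assert (0 < D * E) by nra. apply Rmult_le_pos; nra. }
      assert (h4 : 0 <= V / r * P) by (apply Rmult_le_pos; lra).
      replace ((29 + D * E) * (G + V / r) * P) with
        (29 * (G * P) + 29 * (V / r * P) + D * E * (G * P) + D * E * (V / r) * P) by ring.
      lra.
Qed.

(* [min (rho, t) <= rho^(1-1/p) t^(1/p)] with [t = j^(-p)]. *)
Lemma Rmin_weight_large (p rho j : R) :
  1 <= p -> 0 < rho -> 1 <= j -> Rmin rho (Rpower j (- p)) <= Rpower rho (1 - / p) / j.
Proof.
  intros hp hrho hj. set (t := Rpower j (- p)). assert (ht : 0 < t) by apply Rpower_pos.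
  assert (hp' : 0 < / p <= 1).
  { split; [apply Rinv_0_lt_compat; lra |]. rewrite <- Rinv_1. apply Rinv_le_contravar; lra. }
  assert (e : / j = Rpower t (/ p)).
  { unfold t. rewrite Rpower_mult. replace (- p * / p) with (- (1)) by (field; lra).
    now rewrite Rpower_Ropp, Rpower_1 by lra. }
  unfold Rdiv. rewrite e. set (m := Rmin rho t).
  assert (hm : 0 < m) by (now apply Rmin_pos).
  assert (hm1 : m <= rho) by apply Rmin_l. assert (hm2 : m <= t) by apply Rmin_r.
  apply Rle_trans with (Rpower m (1 - / p) * Rpower m (/ p)).
  - rewrite <- Rpower_plus. replace (1 - / p + / p) with 1 by ring. rewrite Rpower_1 by exact hm. lra.
  - apply Rmult_le_compat; try (left; apply Rpower_pos); apply Rle_Rpower_l; lra.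
Qed.

(** For [p <= 1] the product [j j^(-p)] is nondecreasing in [j], so the largest [j] decides. The
    bound does not involve [rho]: the whole spiral is already as cheap as its core, up to a
    logarithm. *)
Lemma Rmin_weight_small (p r rho j : R) :
  0 < p <= 1 -> 0 < r < 1 -> 1 <= j <= 2 * Rpower r (- / (p + 1)) ->
  Rmin rho (Rpower j (- p)) <= 2 * r * Rpower r (- (2 / (p + 1))) / j.
Proof.
  intros hp hr hj. eapply Rle_trans; [apply Rmin_r |].
  apply Rmult_le_reg_r with j; [lra |].
  replace (2 * r * Rpower r (- (2 / (p + 1))) / j * j)
    with (2 * (r * Rpower r (- (2 / (p + 1))))) by (field; lra).
  replace (Rpower j (- p) * j) with (Rpower j (1 - p)).
  2:{ unfold Rminus. rewrite Rplus_comm, Rpower_plus, Rpower_1; lra. }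
  apply Rle_trans with (Rpower (2 * Rpower r (- / (p + 1))) (1 - p)).
  { apply Rle_Rpower_l; lra. }
  rewrite <- Rpower_mult_distr, Rpower_mult by (lra || apply Rpower_pos).
  apply Rmult_le_compat.
  - left; apply Rpower_pos.
  - left; apply Rpower_pos.
  - rewrite <- (Rpower_1 2) at 2 by lra. apply Rle_Rpower; lra.
  - right. rewrite <- (Rpower_1 r) at 2 by lra. rewrite <- Rpower_plus. f_equal. field. lra.
Qed.

(** With [V = rho^(1-1/p)] the arcs contribute [V / r = r^((theta-1) d)], where [d] is the bound
    that [s] exceeds. The disc term [r^(-2/(p+1))] is dominated by it because [theta <= p/(p+1)],
    with equality of exponents at the end point. *)
Lemma spectrum_exponent_spiral_large (p theta s : R) :
  1 <= p -> 0 < theta < 1 -> theta <= p / (p + 1) ->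
  1 + theta / (p * (1 - theta)) < s -> spectrum_exponent theta (spiral p) s.
Proof.
  intros hp ht ht0 hs.
  set (d := 1 + theta / (p * (1 - theta))) in *.
  set (e := (1 - theta) * (s - d)). assert (he : 0 < e) by (unfold e; nra).
  destruct (covered_spiral_ball p e ltac:(lra) he) as [K [hK hcov]].
  exists (2 * K). split; [lra |]. intros r x hr hx. apply covering_number_le.
  set (rho := Rpower r theta). assert (hrho : 0 < rho) by apply Rpower_pos.
  eapply covered_weaken; [apply Rle_refl | intros z hz; exact hz | |
    apply (hcov r rho (Rpower rho (1 - / p)) x hr hrho)].
  - unfold rho. rewrite Rpower_scale_ratio, Rpower_mult by lra.
    replace ((theta - 1) * s) with ((theta - 1) * d + - e) by (unfold e; ring).
    rewrite Rpower_plus, <- Rmult_assoc.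
    apply Rmult_le_compat_r; [left; apply Rpower_pos |].
    rewrite (Rmult_comm 2 K), Rmult_assoc. apply Rmult_le_compat_l; [lra |].
    assert (e1 : Rpower r (theta * (1 - / p)) / r = Rpower r ((theta - 1) * d)).
    { rewrite <- Rpower_minus_1 by lra. f_equal. unfold d. field. lra. }
    assert (e2 : Rpower r (- (2 / (p + 1))) <= Rpower r ((theta - 1) * d)).
    { apply Rpower_antitone_exponent; [lra |].
      replace ((theta - 1) * d) with (- (1 - theta * (1 - / p))) by (unfold d; field; lra).
      apply Ropp_le_contravar.
      assert (h : theta * (1 - / p) <= p / (p + 1) * (1 - / p)).
      { apply Rmult_le_compat_r; [| exact ht0].
        assert (/ p <= 1) by (rewrite <- Rinv_1; apply Rinv_le_contravar; lra). lra. }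
      replace (p / (p + 1) * (1 - / p)) with (1 - 2 / (p + 1)) in h by (field; lra). lra. }
    lra.
  - left; apply Rpower_pos.
  - intros j hj. apply Rmin_weight_large; lra.
Qed.

Lemma covered_spiral_small (p e : R) :
  0 < p <= 1 -> 0 < e -> exists K, 0 < K /\
  forall (r rho : R) (z0 : C), 0 < r < 1 -> 0 < rho ->
    covered r (ball_in (spiral p) z0 rho) (K * Rpower r (- (2 / (p + 1) + e))).
Proof.
  intros hp he.
  destruct (covered_spiral_ball p e ltac:(lra) he) as [K [hK hcov]].
  exists (3 * K). split; [lra |]. intros r rho z0 hr hrho.
  pose proof (Rpower_pos r (- (2 / (p + 1)))) as hG.
  eapply covered_weaken; [apply Rle_refl | intros z hz; exact hz | |
    apply (hcov r rho (2 * r * Rpower r (- (2 / (p + 1)))) z0 hr hrho)].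
  - rewrite Ropp_plus_distr, Rpower_plus. right. field. lra.
  - apply Rmult_le_pos; lra.
  - intros j hj. now apply Rmin_weight_small.
Qed.

Lemma spectrum_exponent_spiral_small (p theta s : R) :
  0 < p <= 1 -> 0 < theta < 1 -> 2 / ((p + 1) * (1 - theta)) < s ->
  spectrum_exponent theta (spiral p) s.
Proof.
  intros hp ht hs. set (d := 2 / ((p + 1) * (1 - theta))) in *.
  set (e := (1 - theta) * (s - d)). assert (he : 0 < e) by (unfold e; nra).
  destruct (covered_spiral_small p e hp he) as [K [hK hcov]].
  exists K. split; [exact hK |]. intros r x hr hx. apply covering_number_le.
  rewrite Rpower_scale_ratio by lra.
  replace ((theta - 1) * s) with (- (2 / (p + 1) + e)) by (unfold e, d; field; lra).
  apply hcov; [exact hr | apply Rpower_pos].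
Qed.

Lemma box_dim_spiral (p : R) : 0 < p -> is_box_dim (spiral p) (Rmax 1 (2 / (p + 1))).
Proof.
  intros hp. set (d := Rmax 1 (2 / (p + 1))).
  destruct (spiral_core_lower p hp) as [c [hc hcore]].
  (* The whole spiral is its own ball of radius 2 about the origin, so the counts for balls yield
     counts for the box dimension. *)
  assert (hball : forall z, spiral p z -> ball_in (spiral p) (RtoC 0) 2 z).
  { intros z hz. split; [exact hz |]. eapply Rle_trans; [apply Cdist_le_Cmod |].
    rewrite Cmod_0, Rplus_0_r. destruct hz as [x [hx ->]].
    change (Cmod (spiral_at p x) <= 2). rewrite Cmod_spiral_at.
    apply Rle_trans with (Rpower 1 (- p)).
    - apply Rpower_antitone_base; lra.
    - rewrite Rpower_base_1. lra. }
  apply (is_box_dim_of_bounds _ d (Rmin c (/ 4)) 1); [apply Rmin_pos; lra | lra | |].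
  - intros r hr. pose proof (Rpower_pos r (- d)) as hd.
    unfold d in *. destruct (Rle_dec 1 (2 / (p + 1))) as [h | h].
    + rewrite Rmax_right in * by exact h.
      eapply Rle_trans; [| apply hcore with (r := r); [exact hr |]].
      * apply Rmult_le_compat_r; [lra | apply Rmin_l].
      * eapply has_cover_weaken; [apply Rle_refl | |
          apply bounded_covering_number; [lra | now apply bounded_spiral]].
        now intros z [hz _].
    + rewrite Rmax_left in * by lra.
      eapply Rle_trans; [| apply spiral_radial_lower; lra].
      rewrite Rpower_Ropp, Rpower_1 in * by lra.
      replace (/ (4 * r)) with (/ 4 * / r) by (field; lra).
      apply Rmult_le_compat_r; [lra | apply Rmin_r].
  - intros e he. destruct (Rle_lt_dec p 1) as [h | h].
    + destruct (covered_spiral_small p e ltac:(lra) he) as [K [hK hcov]].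
      exists K. split; [exact hK |]. intros r hr. apply covering_number_le.
      eapply covered_weaken; [apply Rle_refl | exact hball | |
        apply hcov; [exact hr | lra]].
      apply Rmult_le_compat_l; [lra |]. apply Rpower_antitone_exponent; [lra |].
      pose proof (Rmax_r 1 (2 / (p + 1))). unfold d. lra.
    + destruct (covered_spiral_ball p e hp he) as [K [hK hcov]].
      set (V := Rpower 2 (1 - / p)). assert (hV : 0 < V) by apply Rpower_pos.
      exists (K * (1 + V)). split; [apply Rmult_lt_0_compat; lra |].
      intros r hr. apply covering_number_le.
      eapply covered_weaken; [apply Rle_refl | exact hball | |
        apply (hcov r 2 V (RtoC 0) hr); [lra | lra |]].
      * rewrite Ropp_plus_distr, Rpower_plus, <- Rmult_assoc.
        apply Rmult_le_compat_r; [left; apply Rpower_pos |].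
        rewrite Rmult_assoc. apply Rmult_le_compat_l; [lra |].
        assert (h1 : / r <= Rpower r (- d)).
        { rewrite <- (Rpower_1 r) at 1 by lra. rewrite <- Rpower_Ropp.
          apply Rpower_antitone_exponent; [lra |].
          pose proof (Rmax_l 1 (2 / (p + 1))). unfold d. lra. }
        assert (h2 : Rpower r (- (2 / (p + 1))) <= Rpower r (- d)).
        { apply Rpower_antitone_exponent; [lra |].
          pose proof (Rmax_r 1 (2 / (p + 1))). unfold d. lra. }
        unfold Rdiv. nra.
      * intros j hj. apply Rmin_weight_large; lra.
Qed.

(** * The dimension constraints in closed form, and the comparison of the three bounds *)

Lemma Rle_div_iff (x y z : R) : 0 < z -> x <= y / z <-> x * z <= y.
Proof.
  intros hz. split; intros h.
  - apply Rmult_le_compat_r with (r := z) in h; [| lra].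
    unfold Rdiv in h. rewrite Rmult_assoc, Rinv_l, Rmult_1_r in h by lra. exact h.
  - apply Rmult_le_reg_r with z; [exact hz |].
    unfold Rdiv. rewrite Rmult_assoc, Rinv_l, Rmult_1_r by lra. exact h.
Qed.

Lemma assouad_allows_iff (p alpha beta : R) :
  0 < p -> 0 < alpha <= 1 -> 1 <= beta ->
  assouad_allows alpha beta unit_interval (spiral p) <->
  alpha * (p + 2 * beta) <= beta * (p + 1).
Proof.
  intros hp ha hb.
  assert (hphi : forall theta, 0 < theta < 1 ->
    assouad_spectrum (alpha * theta / beta) unit_interval = 1).
  { intros theta ht. apply assouad_spectrum_unit_interval.
    split; [apply Rdiv_lt_0_compat; nra |].
    apply Rmult_lt_reg_r with beta; [lra |]. field_simplify; nra. }
  split.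
  - intros h. set (theta := p / (p + 1)).
    assert (ht : 0 < theta < 1).
    { unfold theta. split; [apply Rdiv_lt_0_compat; lra |].
      apply Rmult_lt_reg_r with (p + 1); [lra |]. field_simplify; lra. }
    specialize (h theta ht). rewrite hphi, Rmult_1_r in h by exact ht.
    pose proof (assouad_spectrum_spiral_ge p hp) as h2. fold theta in h2.
    assert (h3 : 2 <= (beta - alpha * theta) / (alpha * beta * (1 - theta))) by lra.
    replace ((beta - alpha * theta) / (alpha * beta * (1 - theta)))
      with ((beta * (p + 1) - alpha * p) / (alpha * beta)) in h3
      by (unfold theta; field; repeat split; lra).
    apply Rle_div_iff in h3; [lra | apply Rmult_lt_0_compat; lra].
  - intros h theta ht. rewrite hphi, Rmult_1_r by exact ht.
    assert (hden : 0 < alpha * beta * (1 - theta)) by (repeat apply Rmult_lt_0_compat; lra).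
    (* After clearing denominators each bound is affine in [theta], with the hypothesis as its
       case [theta = p/(p+1)]. *)
    assert (hred : forall d, assouad_spectrum theta (spiral p) <= d ->
      d * (1 - theta) * (alpha * beta) <= beta - alpha * theta ->
      assouad_spectrum theta (spiral p) <=
      (beta - alpha * theta) / (alpha * beta * (1 - theta))).
    { intros d h1 h2. eapply Rle_trans; [exact h1 |].
      apply Rle_div_iff; [exact hden | lra]. }
    destruct (Rle_lt_dec (p / (p + 1)) theta) as [ht0 | ht0].
    + apply (hred 2).
      * apply spectrum_le_exponent; [exact ht | apply nonempty_spiral |
          now apply bounded_spiral | now apply spectrum_exponent_2].
      * apply Rmult_le_compat_r with (r := p + 1) in ht0; [| lra].
        unfold Rdiv in ht0. rewrite Rmult_assoc, Rinv_l, Rmult_1_r in ht0 by lra.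
        (* The difference of the two sides has slope [alpha (2 beta - 1) > 0] in [theta], so above
           [p/(p+1)] the constraint only becomes easier. *)
        assert (h1 : 0 <= alpha * (2 * beta - 1) * (theta * (p + 1) - p))
          by (repeat apply Rmult_le_pos; lra).
        nra.
    + apply Rmult_lt_compat_r with (r := p + 1) in ht0; [| lra].
      unfold Rdiv in ht0. rewrite Rmult_assoc, Rinv_l, Rmult_1_r in ht0 by lra.
      destruct (Rle_lt_dec p 1) as [hp1 | hp1].
      * apply (hred (2 / ((p + 1) * (1 - theta)))).
        -- apply spectrum_le; [exact ht | apply nonempty_spiral | now apply bounded_spiral |].
           intros s hs. apply spectrum_exponent_spiral_small; lra.
        -- replace (2 / ((p + 1) * (1 - theta)) * (1 - theta) * (alpha * beta))
             with (2 * alpha * beta / (p + 1)) by (field; lra).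
           apply Rmult_le_reg_r with (p + 1); [lra |].
           unfold Rdiv. rewrite Rmult_assoc, Rinv_l, Rmult_1_r by lra. nra.
      * apply (hred (1 + theta / (p * (1 - theta)))).
        -- apply spectrum_le; [exact ht | apply nonempty_spiral | now apply bounded_spiral |].
           intros s hs. apply spectrum_exponent_spiral_large; try lra.
           apply Rmult_le_reg_r with (p + 1); [lra |].
           unfold Rdiv. rewrite Rmult_assoc, Rinv_l, Rmult_1_r by lra. lra.
        -- replace ((1 + theta / (p * (1 - theta))) * (1 - theta) * (alpha * beta))
             with ((p * (1 - theta) + theta) * (alpha * beta) / p) by (field; lra).
           apply Rmult_le_reg_r with p; [lra |].
           unfold Rdiv. rewrite Rmult_assoc, Rinv_l, Rmult_1_r by lra.
           (* Interpolation between the ends of [[0, p/(p+1)]]: [h1] weights the case [theta = 0],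
              which says [alpha <= 1], and [h2] weights the hypothesis. *)
           assert (h1 : 0 <= (p - theta * (p + 1)) * (beta * (1 - alpha)))
             by (repeat apply Rmult_le_pos; lra).
           assert (h2 : theta * (alpha * (p + 2 * beta)) <= theta * (beta * (p + 1)))
             by (apply Rmult_le_compat_l; lra).
           nra.
Qed.

Lemma box_allows_iff (p alpha : R) :
  0 < p -> 0 < alpha <= 1 ->
  box_allows alpha unit_interval (spiral p) <-> alpha <= (p + 1) / 2.
Proof.
  intros hp ha. split.
  - intros h. specialize (h _ _ box_dim_unit_interval (box_dim_spiral p hp)).
    pose proof (Rmax_r 1 (2 / (p + 1))) as h1.
    assert (h2 : 2 / (p + 1) <= 1 / alpha) by lra.
    apply Rmult_le_compat_r with (r := alpha * (p + 1) / 2) in h2; [| nra].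
    replace (2 / (p + 1) * (alpha * (p + 1) / 2)) with alpha in h2 by (field; lra).
    replace (1 / alpha * (alpha * (p + 1) / 2)) with ((p + 1) / 2) in h2 by (field; lra).
    exact h2.
  - intros h dX dY hX hY.
    rewrite (is_box_dim_unique _ _ _ hX box_dim_unit_interval).
    rewrite (is_box_dim_unique _ _ _ hY (box_dim_spiral p hp)).
    apply Rmax_lub; apply Rmult_le_reg_r with alpha; try lra;
      replace (1 / alpha * alpha) with 1 by (field; lra); [lra |].
    apply Rmult_le_reg_r with (p + 1); [lra |].
    replace (2 / (p + 1) * alpha * (p + 1)) with (2 * alpha) by (field; lra). lra.
Qed.

Lemma Rle_Rmin_iff (x y z : R) : x <= Rmin y z <-> x <= y /\ x <= z.
Proof.
  split.
  - intros h. pose proof (Rmin_l y z). pose proof (Rmin_r y z). lra.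
  - intros [h1 h2]. now apply Rmin_glb.
Qed.

(** Suprema are unique, so a bound strictly above the sharp one is not sharp. *)
Lemma sharp_at_unique (p beta : R) (b b' : R -> R) :
  sharp_at p beta b -> sharp_at p beta b' -> b beta = b' beta.
Proof.
  intros [h1 h2] [h1' h2']. apply Rle_antisym; [now apply h2 | now apply h2'].
Qed.

Theorem corollary4p8 (p : R) (hp : 0 < p) :
  let b := fun beta : R => Rmin (p * beta / (p + beta)) 1 in
  let b_assouad := fun beta : R => Rmin ((p * beta + beta) / (p + 2 * beta)) 1 in
  let b_box := fun _ : R => Rmin ((p + 1) / 2) 1 in
  (winding_bound p b /\
   sharp p b /\
   (forall beta : R, 1 <= beta -> winding_exponent p beta (b beta)))
  /\
  (assouad_distortion /\
   (forall alpha beta : R, 0 < alpha <= 1 -> 1 <= beta ->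
      (assouad_allows alpha beta unit_interval (spiral p) <->
       alpha <= b_assouad beta)) /\
   winding_bound p b_assouad /\
   ~ sharp p b_assouad /\
   (forall beta : R, 1 <= beta -> p * beta / (p + beta) < 1 ->
      ~ sharp_at p beta b_assouad))
  /\
  (box_distortion /\
   ex_box_dim unit_interval /\
   ex_box_dim (spiral p) /\
   (forall alpha beta : R, 0 < alpha <= 1 -> 1 <= beta ->
      (box_allows alpha unit_interval (spiral p) <-> alpha <= b_box beta)) /\
   winding_bound p b_box /\
   ~ sharp p b_box /\
   (forall beta : R, 1 <= beta -> p * beta / (p + beta) < 1 ->
      ~ sharp_at p beta b_box)).
Proof.
  intros b b_assouad b_box.
  assert (hbound : winding_bound p b).
  { intros alpha beta hb h. apply Rle_Rmin_iff. split.
    - now apply winding_exponent_le.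
    - apply h. }
  assert (hattained : forall beta, 1 <= beta -> winding_exponent p beta (b beta)).
  { intros beta hb. apply winding_exponent_exists; [exact hp | exact hb | split |].
    - apply Rmin_pos; [apply Rdiv_lt_0_compat; nra | lra].
    - apply Rmin_r.
    - apply Rmin_l. }
  assert (hsharp : sharp p b).
  { intros beta hb. split.
    - intros alpha h. now apply hbound.
    - intros l hl. now apply hl, hattained. }
  assert (hlt : forall beta, 1 <= beta -> p * beta / (p + beta) < 1 ->
    b beta < b_assouad beta /\ b beta < b_box beta).
  { intros beta hb h.
    assert (h' : p * beta < p + beta).
    { apply Rnot_le_lt. intros h1. apply (Rlt_not_le _ _ h). apply Rle_div_iff; lra. }
    unfold b. rewrite Rmin_left by lra. split.
    - apply Rmin_glb_lt; [| exact h].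
      apply Rmult_lt_reg_r with ((p + beta) * (p + 2 * beta)); [nra |].
      replace (p * beta / (p + beta) * ((p + beta) * (p + 2 * beta)))
        with (beta * (p * (p + 2 * beta))) by (field; lra).
      replace ((p * beta + beta) / (p + 2 * beta) * ((p + beta) * (p + 2 * beta)))
        with (beta * ((p + 1) * (p + beta))) by (field; lra).
      apply Rmult_lt_compat_l; nra.
    (* The sharp bound is below both [p] and 1, hence below their mean. *)
    - apply Rmin_glb_lt; [| exact h].
      assert (p * beta / (p + beta) < p); [| lra].
      apply Rmult_lt_reg_r with (p + beta); [lra |].
      replace (p * beta / (p + beta) * (p + beta)) with (p * beta) by (field; lra). nra. }
  assert (hle : forall beta, 1 <= beta -> b beta <= b_assouad beta /\ b beta <= b_box beta).
  { intros beta hb. destruct (Rlt_le_dec (p * beta / (p + beta)) 1) as [h | h].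
    - destruct (hlt beta hb h). lra.
    - apply Rle_div_iff in h; [| lra].
      unfold b, b_assouad, b_box.
      (* Once the sharp bound has reached 1, the other two equal 1 as well. *)
      assert (h1 : 1 < p) by nra. split; apply Rmin_glb; try apply Rmin_r;
        (eapply Rle_trans; [apply Rmin_r |]).
      + apply Rle_div_iff; nra.
      + lra. }
  (* At [beta = 1] the sharp bound is below 1 for every [p], so this [beta] refutes sharpness of
     both dimension bounds. *)
  assert (hone : p * 1 / (p + 1) < 1).
  { apply Rmult_lt_reg_r with (p + 1); [lra |]. field_simplify; lra. }
  assert (hnot_assouad : forall beta, 1 <= beta -> p * beta / (p + beta) < 1 ->
    ~ sharp_at p beta b_assouad).
  { intros beta hb h h'. pose proof (sharp_at_unique _ _ _ _ (hsharp beta hb) h').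
    pose proof (hlt beta hb h). lra. }
  assert (hnot_box : forall beta, 1 <= beta -> p * beta / (p + beta) < 1 ->
    ~ sharp_at p beta b_box).
  { intros beta hb h h'. pose proof (sharp_at_unique _ _ _ _ (hsharp beta hb) h').
    pose proof (hlt beta hb h). lra. }
  split; [| split].
  - now split; [| split].
  - split; [exact assouad_distortion_holds |].
    split; [| split; [| split]]; [| | | exact hnot_assouad].
    + intros alpha beta ha hb. rewrite assouad_allows_iff by assumption.
      unfold b_assouad. rewrite Rle_Rmin_iff, Rle_div_iff by lra.
      replace (p * beta + beta) with (beta * (p + 1)) by ring. lra.
    + intros alpha beta hb h. pose proof (hbound alpha beta hb h). pose proof (hle beta hb). lra.
    + intros h. exact (hnot_assouad 1 (Rle_refl 1) hone (h 1 (Rle_refl 1))).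
  - split; [exact box_distortion_holds |].
    split; [exists 1; exact box_dim_unit_interval |].
    split; [eexists; exact (box_dim_spiral p hp) |].
    split; [| split; [| split]]; [| | | exact hnot_box].
    + intros alpha beta ha hb. rewrite box_allows_iff by assumption.
      unfold b_box. rewrite Rle_Rmin_iff. lra.
    + intros alpha beta hb h. pose proof (hbound alpha beta hb h). pose proof (hle beta hb). lra.
    + intros h. exact (hnot_box 1 (Rle_refl 1) hone (h 1 (Rle_refl 1))).
Qed.
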